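(* Let $f\in\mathbb{C}[x_0,\dots,x_n]$ be a quasihomogeneous polynomial of weighted degree $1$ with respect to weights $w_0,\dots,w_n\in(0,\tfrac12]\cap\mathbb{Q}$, and suppose that $f:(\mathbb{C}^{n+1},0)\to(\mathbb{C},0)$ has an isolated singularity at $0$, with Milnor number $\mu$. Let $\alpha_1\le\dots\le\alpha_\mu$ be the spectral numbers of $f$. Then $$\frac1\mu\sum_{i=1}^{\mu}\left(\alpha_i-\frac{n-1}{2}\right)^2=\frac{\alpha_\mu-\alpha_1}{12}.$$
   Context: Quasihomogeneous of weighted degree $1$ with weights $w_0,\dots,w_n$ means that every monomial $x_0^{a_0}\cdots x_n^{a_n}$ occurring in $f$ satisfies $\sum_i w_ia_i=1$. Let $\mathcal{O}=\mathcal{O}_{\mathbb{C}^{n+1},0}$ be the ring of germs of holomorphic functions, $J_f=\left(\frac{\partial f}{\partial x_0},\dots,\frac{\partial f}{\partial x_n}\right)\subset\mathcal{O}$ the Jacobi ideal, and $\mu=\dim_{\mathbb{C}}\mathcal{O}/J_f<\infty$ the Milnor number. Since $f$ is quasihomogeneous, the Jacobi algebra has a natural grading $\mathcal{O}/J_f=\bigoplus_{\alpha}(\mathcal{O}/J_f)_\alpha$, where $(\mathcal{O}/J_f)_\alpha$ is spanned by the classes of monomials of weighted degree $\alpha$. The spectral numbers of an isolated hypersurface singularity are $\mu$ rational numbers $-1<\alpha_1\le\dots\le\alpha_\mu<n$ with $\alpha_i+\alpha_{\mu+1-i}=n-1$, defined from Steenbrink's Hodge filtration on the cohomology of the Milnor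 fiber. For quasihomogeneous $f$ as in the claim they are given (as a multiset) by $$\alpha_1=-1+\sum_{i=0}^n w_i,\qquad \sharp\{i\mid\alpha_i=\alpha\}=\dim_{\mathbb{C}}(\mathcal{O}/J_f)_{\alpha-\alpha_1}\quad\text{for all }\alpha\in\mathbb{Q},$$ and this description may be taken as their definition here. *)

(* Defs.v *)
(* MathComp and MathComp-Analysis.  The complex numbers are R[i] for an
   arbitrary R : realType; points of C^(n+1) are row vectors. *)
From HB Require Import structures.
From mathcomp Require Import all_boot all_order all_algebra.
From mathcomp Require Import finmap.
From mathcomp Require Import all_classical all_reals all_analysis.
From mathcomp Require Import summability.
From mathcomp Require Import complex.
From mathcomp Require mpoly.
Export (canonicals, coercions, hints) mpoly.

Set Implicit Arguments.
Unset Strict Implicit.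
Unset Printing Implicit Defensive.

Import Order.TTheory GRing.Theory Num.Theory.
Import numFieldNormedType.Exports.

Local Open Scope classical_set_scope.
Local Open Scope ring_scope.

(* R[i], packaged at numFieldType so that it carries the topology that
   MathComp-Analysis puts on every numFieldType, the one given by |.|.  The
   definitions below are for any such C, and are meant at C := Cplx R. *)
Definition Cplx (R : realType) : numFieldType := R[i].

Notation multi_index n := (mpoly.multinom n).

Section HolomorphicGerms.
Variables (C : numFieldType) (n : nat).
Local Notation point := 'rV[C]_n.

Definition monomial (m : multi_index n) (z : point) : C :=
  \prod_(i < n) z 0 i ^+ m i.

(* g is, on a neighbourhood of p, the sum of a power series centred at p;
   summation is over the net of finite sets of multi-indices, i.e. it is
   unconditional (equivalently, absolute). *)
Definition analytic_at (g : point -> C) (p : point) : Prop :=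
  exists a : multi_index n -> C, \forall z \near p,
    partial_sum (fun m => a m * monomial m (z - p)) @ totally --> g z.

(* g represents an element of O_{C^n,0}.  Two such functions have the same germ
   iff they agree near 0; functions rather than classes are used throughout. *)
Definition holomorphic_germ (g : point -> C) : Prop :=
  \forall p \near (0 : point), analytic_at g p.

Definition poly_fun (p : mpoly.mpoly n C) : point -> C :=
  fun z => mpoly.meval (fun i => z 0 i) p.

(* Functions whose germ lies in the ideal of O generated by the partial
   derivatives of f. *)
Definition jacobi_ideal (f : mpoly.mpoly n C) : set (point -> C^o) :=
  [set g | exists2 h : 'I_n -> point -> C,
    (forall i, holomorphic_germ (h i)) &
    \forall z \near (0 : point),
      g z = \sum_(i < n) h i z * poly_fun (mpoly.mderiv i f) z].

Definition isolated_singularity (f : mpoly.mpoly n C) : Prop :=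
  [/\ poly_fun f 0 = 0,
      forall i, poly_fun (mpoly.mderiv i f) 0 = 0 &
      \forall z \near (0 : point),
        z != 0 -> exists i, poly_fun (mpoly.mderiv i f) z != 0].

End HolomorphicGerms.

(* For subspaces W and J of V, the image of W in V / J has dimension d. *)
Definition has_dim_mod (K : fieldType) (V : lmodType K) (W J : set V) (d : nat)
  : Prop :=
  exists e : 'I_d -> V,
    [/\ forall i, W (e i),
        forall c : 'I_d -> K, J (\sum_i c i *: e i) -> forall i, c i = 0 &
        forall v, W v -> exists c : 'I_d -> K, J (v - \sum_i c i *: e i)].

Section Spectrum.
Variables (C : numFieldType) (n : nat).

Definition weighted_degree (w : 'I_n -> rat) (m : multi_index n) : rat :=
  \sum_(i < n) w i * (m i)%:R.

Definition quasihomogeneous (w : 'I_n -> rat) (b : rat) (p : mpoly.mpoly n C)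
  : Prop :=
  forall m : multi_index n, m \in mpoly.msupp p -> weighted_degree w m = b.

(* mu = dim_C O / J_f *)
Definition has_milnor_number (f : mpoly.mpoly n C) (mu : nat) : Prop :=
  has_dim_mod [set g : 'rV[C]_n -> C^o | holomorphic_germ g]
              (jacobi_ideal f) mu.

(* d = dim_C (O / J_f)_b; the linear span of the monomials of weighted degree
   b consists of the quasihomogeneous polynomials of weighted degree b. *)
Definition has_graded_dim (w : 'I_n -> rat) (f : mpoly.mpoly n C) (b : rat)
  (d : nat) : Prop :=
  has_dim_mod
    [set g : 'rV[C]_n -> C^o |
      exists2 p, quasihomogeneous w b p & g = poly_fun p]
    (jacobi_ideal f) d.

Definition is_spectrum (w : 'I_n -> rat) (f : mpoly.mpoly n C) (mu : nat)
  (alpha : mu.-tuple rat) : Prop :=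
  let alpha1 := -1 + \sum_(i < n) w i in
  sorted <=%R alpha /\
  forall a : rat, has_graded_dim w f (a - alpha1) (count_mem a alpha).

End Spectrum.

(* Main.v *)
(* The Jacobi algebra C[x] / (d_0 f, ..., d_n f) is graded, and it is finite
   dimensional since there are only finitely many spectral numbers.  By depth
   sensitivity of Koszul homology, n+1 homogeneous elements of C[x] with a finite
   dimensional quotient form a regular sequence, so the Hilbert series of the
   quotient is prod_i (1 - t^(deg g_i)) times the Hilbert series of C[x].  Using
   this for the partial derivatives, of degree 1 - w_i, and for the variables, of
   degree w_i, gives
     sum_j t^(alpha_j - alpha_1) * prod_i (1 - t^(w_i)) = prod_i (1 - t^(1 - w_i)).
   The extreme exponents of this identity give alpha_mu - alpha_1, and with
   t = exp(u) its expansion at u = 0 up to relative order u^2 gives the variance.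
   The definitions use germs of holomorphic functions; the action
   x_i -> t^(w_i) x_i extracts the homogeneous components of convergent power
   series, whence a homogeneous polynomial that lies in J_f as a germ already lies
   in the ideal generated by the d_i f in C[x]. *)
Require Import Defs.
From mathcomp Require Import all_boot all_order all_algebra.
From mathcomp Require Import all_classical all_reals all_analysis.
From mathcomp Require mpoly.
From HB Require Import structures.
From mathcomp Require Import finmap summability.
From mathcomp Require Import ring lra zify.
Import -(notations) mpoly.

Set Implicit Arguments.
Unset Strict Implicit.
Unset Printing Implicit Defensive.

Import Order.TTheory GRing.Theory Num.Theory.
Import numFieldNormedType.Exports.
Local Open Scope ring_scope.

(** * Koszul homology and depth *)

Section Koszul.
Variable A : comNzRingType.
Implicit Types (a z p q : A) (gs bs : seq A) (c e u v : seq bool -> A) (s : seq bool).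

(* A Koszul chain over [gs] is a function on the [s : seq bool] with
   [size s = size gs]; [s] selects the generators in an exterior monomial, so the
   homological degree is [count id s].  Values at other [s] are irrelevant. *)
Fixpoint koszul_d gs c s : A :=
  match gs, s with
  | a :: gs', false :: s' =>
      koszul_d gs' (c \o cons false) s' + a * c (true :: s')
  | _ :: gs', true :: s' => - koszul_d gs' (c \o cons true) s'
  | _, _ => 0
  end.

(* Exterior multiplication by the vector [bs]. *)
Fixpoint koszul_h bs c s : A :=
  match bs, s with
  | _ :: bs', false :: s' => koszul_h bs' (c \o cons false) s'
  | b :: bs', true :: s' =>
      b * c (false :: s') - koszul_h bs' (c \o cons true) s'
  | _, _ => 0
  end.

Definition lincomb bs gs : A := \sum_(x <- zip bs gs) x.1 * x.2.

Lemma koszul_d_comb gs c1 c2 p q c s : (forall t, c t = p * c1 t + q * c2 t) ->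
  koszul_d gs c s = p * koszul_d gs c1 s + q * koszul_d gs c2 s.
Proof.
elim: gs c c1 c2 s => [|a gs IH] c c1 c2 [|[] s] cE /=; try ring.
- by rewrite (IH _ (c1 \o cons true) (c2 \o cons true)) => [|t]; [ring|exact: cE].
- rewrite (IH _ (c1 \o cons false) (c2 \o cons false)) => [|t]; last exact: cE.
  by rewrite cE; ring.
Qed.

Lemma koszul_h_comb bs c1 c2 p q c s : (forall t, c t = p * c1 t + q * c2 t) ->
  koszul_h bs c s = p * koszul_h bs c1 s + q * koszul_h bs c2 s.
Proof.
elim: bs c c1 c2 s => [|a bs IH] c c1 c2 [|[] s] cE /=; try ring.
- rewrite (IH _ (c1 \o cons true) (c2 \o cons true)) => [|t]; last exact: cE.
  by rewrite cE; ring.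
- by rewrite (IH _ (c1 \o cons false) (c2 \o cons false)) => [|t]; [ring|exact: cE].
Qed.

Lemma koszul_dd gs c s : koszul_d gs (koszul_d gs c) s = 0.
Proof.
elim: gs c s => [|a gs IH] c [|[] s] //=.
- rewrite (@koszul_d_comb _ (koszul_d gs (c \o cons true)) (fun=> 0) (-1) 0).
    by rewrite IH; ring.
  by move=> t /=; ring.
- rewrite (@koszul_d_comb _ (koszul_d gs (c \o cons false)) (c \o cons true) 1 a).
    by rewrite IH; ring.
  by move=> t /=; ring.
Qed.

(** Cartan's formula: contraction with [gs] and exterior multiplication by [bs] anticommute up to
    their scalar pairing. Hence every element of the ideal of [gs] acts as zero on Koszul
    homology. *)
Lemma koszul_homotopy gs bs c s : size s = size gs -> size bs = size gs ->
  koszul_d gs (koszul_h bs c) s + koszul_h bs (koszul_d gs c) s =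
  lincomb bs gs * c s.
Proof.
rewrite /lincomb; elim: gs bs c s => [|a gs IH] [|b bs] c [|x s] //=.
  by rewrite big_nil; move=> _ _; ring.
move=> [ss] [sb]; rewrite big_cons [(b, a).1]/= [(b, a).2]/=.
case: x => /=; rewrite mulrDl.
- rewrite (@koszul_d_comb _ (c \o cons false) (koszul_h bs (c \o cons true)) b
    (-1)); last by move=> t /=; ring.
  rewrite (@koszul_h_comb _ (koszul_d gs (c \o cons true)) (fun=> 0) (-1) 0);
    last by move=> t /=; ring.
  by rewrite -(IH bs (c \o cons true) s) //=; ring.
- rewrite (@koszul_h_comb _ (koszul_d gs (c \o cons false)) (c \o cons true) 1 a
    (koszul_d (a :: gs) c \o cons false));
    last by move=> t /=; ring.
  rewrite -(IH bs (c \o cons false) s) //=.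
  rewrite (_ : (fun _ => _) \o _ = koszul_h bs (c \o cons false)) //; ring.
Qed.

Definition koszul_deg i c := forall s, count id s != i -> c s = 0.

(** A predicate on degrees lets the induction pass to [P \o S] below a leading [true]. With
    [P := pred1 0] it says that chains of degree 0 have zero differential. *)
Lemma koszul_d_supp (P : pred nat) gs c :
  (forall s, ~~ P (count id s) -> c s = 0) ->
  forall s, ~~ P (count id s).+1 -> koszul_d gs c s = 0.
Proof.
elim: gs P c => [|a gs IH] P c Hc [|[] s] //= Hs.
- by rewrite (IH (P \o S)) ?oppr0// => t /= Ht; apply: Hc.
- rewrite (IH P) ?Hc ?mulr0 ?addr0 // => t Ht; exact: Hc.
Qed.

Lemma koszul_h_supp (P : pred nat) bs c :
  (forall s, ~~ P (count id s).+1 -> c s = 0) ->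
  forall s, ~~ P (count id s) -> koszul_h bs c s = 0.
Proof.
elim: bs P c => [|b bs IH] P c Hc [|[] s] //= Hs.
- by rewrite Hc // mulr0 (IH (P \o S)) ?subr0// => t /= Ht; apply: Hc.
- by rewrite (IH P) // => t Ht; apply: Hc.
Qed.

Lemma koszul_h_deg i bs c : koszul_deg i c -> koszul_deg i.+1 (koszul_h bs c).
Proof.
move=> Hc; apply: (koszul_h_supp (P := pred1 i.+1)) => s /= Hs.
by apply: Hc; rewrite eqSS in Hs.
Qed.

Lemma koszul_d_deg i gs c : koszul_deg i.+1 c -> koszul_deg i (koszul_d gs c).
Proof.
move=> Hc s Hs; apply: (koszul_d_supp (P := pred1 i.+1)) => //=.
Qed.

(* [koszul_exact gs I i]: the i-th Koszul homology of [gs] on A / I vanishes. *)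
Definition koszul_exact gs (I : A -> Prop) i := forall c, koszul_deg i c ->
  (forall s, size s = size gs -> I (koszul_d gs c s)) ->
  exists2 e, koszul_deg i.+1 e &
    forall s, size s = size gs -> I (c s - koszul_d gs e s).

Definition is_ideal (I : A -> Prop) :=
  [/\ I 0, forall p q, I p -> I q -> I (p + q) & forall p q, I q -> I (p * q)].

Lemma ideal_d I gs c : is_ideal I -> (forall s, size s = size gs -> I (c s)) ->
  forall s, size s = size gs -> I (koszul_d gs c s).
Proof.
case=> I0 ID IM; elim: gs c => [|a gs IH] c Hc [|[] s] //= [ss].
- by rewrite -mulN1r; apply: IM; apply: IH => // t Ht; apply: Hc; rewrite /= Ht.
- apply: ID; last by apply/IM/Hc; rewrite /= ss.
  by apply: IH => // t Ht; apply: Hc; rewrite /= Ht.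
Qed.

Lemma ideal_h I bs c : is_ideal I -> (forall s, size s = size bs -> I (c s)) ->
  forall s, size s = size bs -> I (koszul_h bs c s).
Proof.
case=> I0 ID IM; elim: bs c => [|a bs IH] c Hc [|[] s] //= [ss].
- apply: ID; first by apply/IM/Hc; rewrite /= ss.
  by rewrite -mulN1r; apply: IM; apply: IH => // t Ht; apply: Hc; rewrite /= Ht.
- by apply: IH => // t Ht; apply: Hc; rewrite /= Ht.
Qed.

(* Depth sensitivity: z annihilates the Koszul homology of gs, so that the long
   exact sequence of 0 -> A/I -> A/I -> A/I' -> 0 splits into short ones. *)
Lemma koszul_exact_quotient gs bs z (I I' : A -> Prop) i :
  is_ideal I -> size bs = size gs -> z = lincomb bs gs ->
  (forall p, I (z * p) -> I p) ->
  (forall p, I' p <-> exists q, I (p - z * q)) ->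
  koszul_exact gs I' i.+1 -> koszul_exact gs I i.
Proof.
move=> idI sb zE regz I'P ex c cdeg cycle; have [I0 ID IM] := idI.
have IN p : I p -> I (- p) by rewrite -mulN1r; apply: IM.
(* Modulo [I] the homotopy formula loses its term in [koszul_d gs c], so [z c] is the boundary of
   [koszul_h bs c]. *)
have zc s : size s = size gs ->
    I (z * c s - koszul_d gs (koszul_h bs c) s).
  move=> ss; rewrite zE -(koszul_homotopy c ss sb) addrC addKr.
  by apply: ideal_h => //; rewrite sb.
(* By [zc], [koszul_h bs c] is a cycle modulo [I'], hence a boundary modulo [I']. *)
have [||f fdeg fP] := ex (koszul_h bs c).
- exact: koszul_h_deg.
- move=> s ss; apply/I'P; exists (c s).
  by rewrite -opprB; apply/IN/zc.
have /choice[q qP] : forall s, exists q, size s = size gs ->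
    I (koszul_h bs c s - koszul_d gs f s - z * q).
  move=> s; case: (eqVneq (size s) (size gs)) => [ss|/eqP ns]; last by exists 0 => /ns.
  by have /I'P[q Hq] := fP _ ss; exists q.
(* The [q s] are arbitrary choices, so they are cut down to degree [i.+1]; elsewhere [koszul_h bs c]
   and [koszul_d gs f] vanish. *)
pose e s := if count id s == i.+1 then q s else 0.
exists e => [s|s ss]; first by rewrite /e => /negbTE ->.
(* The differential of [koszul_h bs c - koszul_d gs f - z e] lies in [I]; its first term is [z c]
   modulo [I] and its second is zero, so [z] times the difference of [c] and [koszul_d gs e] lies in
   [I]. *)
apply: regz.
have eP t : size t = size gs -> I (koszul_h bs c t - koszul_d gs f t - z * e t).
  rewrite /e; case: eqP => [_|/eqP nt] st; first exact: qP.
  by rewrite (koszul_h_deg bs cdeg) // (koszul_d_deg gs fdeg) // !(subr0, mulr0).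
have := ideal_d idI eP ss.
rewrite (@koszul_d_comb _ (fun t => koszul_h bs c t - koszul_d gs f t) e 1 (- z));
  last by move=> t; ring.
rewrite (@koszul_d_comb _ (koszul_h bs c) (koszul_d gs f) 1 (-1));
  last by move=> t; ring.
rewrite koszul_dd => /(ID _ _ (zc _ ss)).
by congr (I _); ring.
Qed.

(** The recursion adjoins one generator at a time, in step with [koszul_d] and with successive
    quotients. *)
Fixpoint in_ideal gs p : Prop :=
  if gs is a :: gs' then exists q, in_ideal gs' (p - a * q) else p = 0.

Lemma in_ideal_is_ideal gs : is_ideal (in_ideal gs).
Proof.
elim: gs => [|a gs [I0 ID IM]] /=.
  by split=> // p q => [-> ->|->]; rewrite ?addr0 ?mulr0.
split=> [|p q [r rP] [t tP]|p q [r rP]].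
- by exists 0; rewrite mulr0 subr0.
- by exists (r + t); have := ID _ _ rP tP; congr (in_ideal _ _); ring.
- by exists (p * r); have := IM p _ rP; congr (in_ideal _ _); ring.
Qed.

Lemma in_ideal_lincomb gs p :
  in_ideal gs p <-> exists2 bs, size bs = size gs & p = lincomb bs gs.
Proof.
rewrite /lincomb; elim: gs p => [|a gs IH] p /=; split.
- by move=> ->; exists [::]; rewrite // big_nil.
- by move=> [[]// _ ->]; rewrite big_nil.
- move=> [q /IH[bs sb pE]]; exists (q :: bs); rewrite /= ?sb //.
  by rewrite big_cons -pE /=; ring.
- move=> [[//|b bs] [sb] ->]; exists b; apply/IH; exists bs => //.
  by rewrite big_cons /=; ring.
Qed.

Lemma in_ideal_koszul_d gs c : in_ideal gs (koszul_d gs c (nseq (size gs) false)).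
Proof.
elim: gs c => [|a gs IH] c //=; exists (c (true :: nseq (size gs) false)).
by rewrite addrK.
Qed.

Lemma koszul_d0 gs s : koszul_d gs (fun=> 0) s = 0.
Proof.
by rewrite (@koszul_d_comb _ (fun=> 0) (fun=> 0) 0 0); [ring | move=> _; ring].
Qed.

(** Together with [in_ideal_koszul_d] this identifies the zeroth Koszul homology with the quotient
    by the ideal of [gs]. *)
Lemma koszul_d_surj gs p : in_ideal gs p -> exists2 c, koszul_deg 1 c &
  forall s, size s = size gs ->
    koszul_d gs c s = if count id s == 0 then p else 0.
Proof.
elim: gs p => [|a gs IH] p /=.
  by move=> ->; exists (fun=> 0) => // -[].
move=> [q /IH[c cdeg cP]].
exists (fun s => if s is x :: s' then
    if x then if count id s' == 0 then q else 0 else c s' else 0).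
  by case=> [|[] s] /=; [|rewrite add1n eqSS => /negbTE ->|apply: cdeg].
case=> [|[] s] //= [ss].
  rewrite (koszul_d_supp (P := pred1 0)) ?oppr0 // => t /=.
  by case: eqP.
rewrite (_ : koszul_d gs _ s = koszul_d gs c s) // cP // ?add0n.
by case: (count id s == 0); ring.
Qed.

End Koszul.

(** * Dimensions of subquotients *)

Definition is_subspace (K : fieldType) (V : lmodType K) (W : set V) :=
  [/\ W 0, forall u v, W u -> W v -> W (u + v) & forall a v, W v -> W (a *: v)].

Section Subspace.
Variables (K : fieldType) (V : lmodType K) (W : set V).
Hypothesis subW : is_subspace W.

Lemma subspaceB u v : W u -> W v -> W (u - v).
Proof.
by case: subW => _ WD WZ Wu Wv; apply: WD => //; rewrite -scaleN1r; apply: WZ.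
Qed.

Lemma subspace_sum (I : finType) (F : I -> V) :
  (forall i, W (F i)) -> W (\sum_i F i).
Proof. by case: subW => W0 WD _ WF; elim/big_ind: _ => //. Qed.

Lemma subspace_comb (I : finType) (c : I -> K) (F : I -> V) :
  (forall i, W (F i)) -> W (\sum_i c i *: F i).
Proof.
by move=> WF; apply: subspace_sum => i; have [_ _ WZ] := subW; apply: WZ.
Qed.

End Subspace.

Lemma mulmx_comb (K : fieldType) (V : lmodType K) p q (x : 'rV[K]_p)
    (M : 'M[K]_(p, q)) (e : 'I_q -> V) :
  \sum_j (x *m M) 0 j *: e j = \sum_i x 0 i *: (\sum_j M i j *: e j).
Proof.
under eq_bigr do rewrite mxE scaler_suml.
rewrite exchange_big; apply: eq_bigr => i _ /=; rewrite scaler_sumr.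
by apply: eq_bigr => j _; rewrite scalerA.
Qed.

Lemma has_dim_mod_coker (K : fieldType) (V : lmodType K) (W' J' W J J2 : set V)
    (T : {linear V -> V}) (p q : nat) :
  is_subspace W' -> is_subspace J -> is_subspace W ->
  (forall v, W' v -> W (T v)) -> (forall v, W' v -> J (T v) <-> J' v) ->
  (forall v, W v -> J2 v <-> exists2 u, W' u & J (v - T u)) ->
  has_dim_mod W' J' p -> has_dim_mod W J q ->
  exists2 d, has_dim_mod W J2 d & (p + d = q)%N.
Proof.
move=> sW' sJ sW TW TJ J2P [e' [We' indep' span']] [e [We indep span]].
have [J0 JD JZ] := sJ.
have /choice[M0 M0P] : forall i, exists c : 'I_q -> K,
    J (T (e' i) - \sum_j c j *: e j) by move=> i; apply/span/TW.
pose M : 'M[K]_(p, q) := \matrix_(i, j) M0 i j.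
have MP (x : 'rV_p) :
    J (T (\sum_i x 0 i *: e' i) - \sum_j (x *m M) 0 j *: e j).
  rewrite mulmx_comb linear_sum -sumrB; apply: subspace_sum => // i.
  rewrite linearZ -scalerBr; apply: JZ; under eq_bigr do rewrite mxE.
  exact: M0P.
have JMe (x : 'rV_q) : J (\sum_j x 0 j *: e j) -> x = 0.
  by move=> /indep x0; apply/rowP => j; rewrite mxE.
have JB := subspaceB sJ.
have W'x (x : 'rV_p) : W' (\sum_i x 0 i *: e' i) by apply: subspace_comb.
have freeM : row_free M.
  apply: inj_row_free => x xM0; have := MP x.
  rewrite xM0 [X in _ - X]big1 ?subr0 => [|j _]; last by rewrite mxE scale0r.
  by move=> /TJ - /(_ (W'x x)) /indep' x0; apply/rowP => i; rewrite mxE.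
pose N := row_base (M^C)%MS.
have MN0 (x : 'rV_p) (y : 'rV_(\rank (M^C)%MS)) : y *m N = x *m M -> x = 0 /\ y = 0.
  move=> yx; have : (y *m N <= M :&: M^C)%MS.
    by rewrite sub_capmx {1}yx submxMl (submx_trans (submxMl _ _)) // eq_row_base.
  rewrite capmx_compl submx0 => /eqP yN0; split.
    by apply/eqP; rewrite -(mulmx_free_eq0 _ freeM) -yx yN0.
  by apply/eqP; rewrite -(mulmx_free_eq0 _ (row_base_free (M^C)%MS)) yN0.
pose e2 k := \sum_j N k j *: e j.
have We2 k : W (e2 k) by apply: subspace_comb.
exists (\rank (M^C)%MS); last first.
  by rewrite mxrank_compl (eqP freeM) subnKC // -(eqP freeM) rank_leq_col.
exists e2; split => // [c|v Wv].
- have -> : \sum_k c k *: e2 k = \sum_j ((\row_k c k) *m N) 0 j *: e j.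
    by rewrite mulmx_comb; apply: eq_bigr => k _; rewrite mxE.
  move=> /J2P[|u W'u Ju]; first exact: subspace_comb.
  have [x xP] := span' u W'u; pose y := \row_k c k.
  have Jux : J (T u - \sum_j ((\row_i x i) *m M) 0 j *: e j).
    have := JD _ _ (MP (\row_i x i)) ((TJ _ (subspaceB sW' W'u (W'x (\row_i x i)))).2 _).
    rewrite [X in J X]addrC [T (u - _)]linearB subrKA; apply; move: xP; congr (J' (_ - _)).
    by apply: eq_bigr => i _; rewrite mxE.
  have := JD _ _ Ju Jux; rewrite subrKA -sumrB.
  under eq_bigr do rewrite -scalerBl.
  move=> J0'; have [|_ /rowP y0 k] := @MN0 (\row_i x i) y.
    apply/subr0_eq/JMe; move: J0'; congr (J _); apply: eq_bigr => j _.
    by congr (_ *: _); rewrite !mxE.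
  by have := y0 k; rewrite !mxE.
- have [c cP] := span v Wv.
  have : (\row_j c j <= M + N)%MS.
    apply: submx_trans (submx1 _) _; have := addsmx_compl_full M.
    by rewrite -sub1mx => /submx_trans; apply; rewrite addsmxS // eq_row_base.
  move=> /sub_addsmxP[[x y] /= cE]; exists (fun k => y 0 k).
  rewrite (_ : \sum_k _ = \sum_j (y *m N) 0 j *: e j); last first.
    by rewrite mulmx_comb.
  apply/J2P; last exists (\sum_i x 0 i *: e' i) => //.
    by apply: subspaceB => //; apply: subspace_comb.
  have cM : \sum_j c j *: e j =
      \sum_j (x *m M) 0 j *: e j + \sum_j (y *m N) 0 j *: e j.
    rewrite -big_split; apply: eq_bigr => j _ /=; rewrite -scalerDl.
    by move/rowP: cE => /(_ j); rewrite !mxE => ->.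
  have := JB _ _ cP (MP x).
  by rewrite cM opprB opprD [- (\sum_j _) - _]addrC [v + _]addrA subrKA.
Qed.

(** The cokernel lemma applied to the identity gives one inequality, and the roles of [p] and [q]
    can be exchanged. *)
Lemma has_dim_mod_inj (K : fieldType) (V : lmodType K) (W J : set V) (p q : nat) :
  is_subspace J -> is_subspace W ->
  has_dim_mod W J p -> has_dim_mod W J q -> p = q.
Proof.
move=> sJ sW; suff le p' q' : has_dim_mod W J p' -> has_dim_mod W J q' -> (p' <= q')%N.
  by move=> Wp Wq; apply/eqP; rewrite eqn_leq !le.
move=> Wp Wq.
have [] := @has_dim_mod_coker K V W J W J (fun v => exists2 u, W u & J (v - u))
  idfun p' q' sW sJ sW _ _ _ Wp Wq => // d _ <-; exact: leq_addr.
Qed.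

Lemma eq_has_dim_mod (K : fieldType) (V : lmodType K) (W J J' : set V) d :
  is_subspace W -> (forall v, W v -> J v <-> J' v) ->
  has_dim_mod W J d -> has_dim_mod W J' d.
Proof.
move=> sW JJ' [e [We indep span]]; exists e; split => // [c Jc|v Wv].
  by apply/indep/JJ' => //; apply: subspace_comb.
have [c Jc] := span v Wv; exists c; apply/JJ' => //.
by apply: subspaceB => //; apply: subspace_comb.
Qed.

(** * Homogeneous components *)

Section Graded.
Variables (C : numFieldType) (n : nat) (w : 'I_n -> rat).
Local Notation A := (mpoly n C).
Local Notation qh := (quasihomogeneous w).
Local Notation wdeg := (weighted_degree w).
Implicit Types (p q : A) (b : rat) (m : multi_index n).

Lemma wdegD m1 m2 : wdeg (mnm_add m1 m2) = wdeg m1 + wdeg m2.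
Proof.
rewrite /weighted_degree -big_split; apply: eq_bigr => i _ /=.
by rewrite mnmDE natrD mulrDr.
Qed.

Lemma wdeg_mnm1 i : wdeg (mnm1 i) = w i.
Proof.
rewrite /weighted_degree (bigD1 i) //= mnm1E eqxx mulr1 big1 ?addr0 // => j /negbTE ji.
by rewrite mnm1E eq_sym ji mulr0.
Qed.

Hypothesis w_gt0 : forall i, 0 < w i.

Lemma wdeg_ge0 m : 0 <= wdeg m.
Proof. by apply: sumr_ge0 => i _; rewrite mulr_ge0 ?ler0n ?ltW. Qed.

Definition hpart b p : A :=
  \sum_(m <- msupp p | wdeg m == b) mcoeff m p *: mpolyX C m.

Lemma mcoeff_hpart b p m :
  mcoeff m (hpart b p) = if wdeg m == b then mcoeff m p else 0.
Proof.
rewrite /hpart raddf_sum /=; under eq_bigr do rewrite mcoeffZ mcoeffX.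
case: ifP => mb.
  have [mp|mp] := boolP (m \in msupp p); last first.
    rewrite memN_msupp_eq0 // big_seq_cond big1 // => k /andP[kp _].
    by rewrite (negbTE (memPn mp k kp)) mulr0.
  rewrite big_mkcond (bigD1_seq m) //= mb eqxx mulr1 big1 ?addr0 // => k /negbTE ->.
  by rewrite mulr0 if_same.
by rewrite big1 // => k kb; case: eqP => [km|_]; rewrite ?mulr0 //; rewrite km mb in kb.
Qed.

Lemma qhE b p : qh b p <-> forall m, wdeg m != b -> mcoeff m p = 0.
Proof.
split=> [pb m /eqP mb|pb m]; last first.
  rewrite mcoeff_msupp => mp; apply/eqP; apply: contraNT mp => mb.
  by rewrite pb.
by apply: memN_msupp_eq0; apply/negP => /pb.
Qed.

Lemma qh_hpart b p : qh b (hpart b p).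
Proof. by apply/qhE => m /negbTE mb; rewrite mcoeff_hpart mb. Qed.

Lemma hpart_qh b p : qh b p -> hpart b p = p.
Proof.
move=> /qhE pb; apply/mpolyP => m; rewrite mcoeff_hpart.
by case: eqVneq => // /pb.
Qed.

Lemma hpartD b p q : hpart b (p + q) = hpart b p + hpart b q.
Proof.
by apply/mpolyP => m; rewrite mcoeffD !mcoeff_hpart; case: eqP => _; rewrite ?mcoeffD ?addr0.
Qed.

Lemma hpartZ b (k : C) p : hpart b (k *: p) = k *: hpart b p.
Proof.
by apply/mpolyP => m; rewrite mcoeffZ !mcoeff_hpart; case: eqP => _; rewrite ?mcoeffZ ?mulr0.
Qed.

Lemma hpart0 b : hpart b 0 = 0.
Proof. by apply/mpolyP => m; rewrite mcoeff_hpart mcoeff0 if_same. Qed.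

Lemma hpartN b p : hpart b (- p) = - hpart b p.
Proof. by rewrite -scaleN1r hpartZ scaleN1r. Qed.

Lemma hpart_sum b (I : Type) (r : seq I) (P : pred I) (F : I -> A) :
  hpart b (\sum_(i <- r | P i) F i) = \sum_(i <- r | P i) hpart b (F i).
Proof. exact: (big_morph _ (hpartD b) (hpart0 b)). Qed.

Lemma hpartX b m : hpart b (mpolyX C m) = if wdeg m == b then mpolyX C m else 0.
Proof.
apply/mpolyP => k; rewrite mcoeff_hpart mcoeffX.
case: (eqVneq m k) => [->|mk]; case: eqP => _; rewrite ?mcoeffX ?eqxx ?mcoeff0 //;
  by case: eqP => _; rewrite ?mcoeffX ?(negbTE mk) ?mcoeff0.
Qed.

Lemma qh_comb b p q (k : C) : qh b p -> qh b q -> qh b (k *: p + q).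
Proof.
by move=> /qhE pb /qhE qb; apply/qhE => m mb; rewrite mcoeffD mcoeffZ pb // qb // mulr0 addr0.
Qed.

Lemma qh0 b : qh b (0 : A).
Proof. by apply/qhE => m _; rewrite mcoeff0. Qed.

Lemma qhX m : qh (wdeg m) (mpolyX C m).
Proof.
apply/qhE => k km; rewrite mcoeffX; case: eqP => // mk.
by rewrite mk eqxx in km.
Qed.

Lemma qh_subspace b : is_subspace [set p : A | qh b p].
Proof.
split=> /= [|p q pb qb|k p pb]; first exact: qh0.
  by rewrite -[p]scale1r; apply: qh_comb.
by rewrite -[_ *: _]addr0; apply: qh_comb => //; apply: qh0.
Qed.

Lemma hpartM e b p q : qh e p -> hpart b (p * q) = p * hpart (b - e) q.
Proof.
move=> pe; rewrite [p in LHS]mpolyE [p in RHS]mpolyE !mulr_suml hpart_sum.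
rewrite big_seq [RHS]big_seq; apply: eq_bigr => m /pe me.
rewrite -!scalerAl hpartZ; congr (_ *: _).
rewrite [q in LHS]mpolyE [q in RHS]mpolyE mulr_sumr !hpart_sum mulr_sumr.
apply: eq_bigr => k _; rewrite -scalerAr !hpartZ -scalerAr; congr (_ *: _).
rewrite !hpartX -mpolyXD hpartX wdegD me [wdeg k == _]eq_sym subr_eq.
by rewrite [wdeg k + e]addrC [b == _]eq_sym; case: ifP => _; rewrite ?mpolyXD ?mulr0.
Qed.

Lemma qhM e b p q : qh e p -> qh b q -> qh (e + b) (p * q).
Proof.
move=> pe qb; have := @qh_hpart (e + b) (p * q).
by rewrite (hpartM _ _ pe) (_ : e + b - e = b) ?(hpart_qh qb) //; ring.
Qed.

Fixpoint qh_seq (es : seq rat) (gs : seq A) : Prop :=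
  match es, gs with
  | [::], [::] => True
  | e :: es', g :: gs' => qh e g /\ qh_seq es' gs'
  | _, _ => False
  end.

Lemma hpart_ideal es gs b p : qh_seq es gs -> in_ideal gs p -> in_ideal gs (hpart b p).
Proof.
elim: gs es b p => [|g gs IH] [|e es] b p //=; first by move=> _ ->; exact: hpart0.
move=> [ge gses] [q pq]; exists (hpart (b - e) q).
by rewrite -(hpartM _ _ ge) -hpartN -hpartD; exact: (IH es).
Qed.

(** The weight of an exterior monomial. A chain of internal degree [b] has at [s] a coefficient of
    weighted degree [b - koszul_wt es s]; the Koszul differential preserves this internal degree. *)
Fixpoint koszul_wt (es : seq rat) (s : seq bool) : rat :=
  match es, s with
  | e :: es', x :: s' => (if x then e else 0) + koszul_wt es' s'
  | _, _ => 0
  end.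

Lemma koszul_wt0 es s : count id s == 0 -> koszul_wt es s = 0.
Proof.
by elim: s es => [|[] s IH] [|e es] //=; rewrite add0n => /IH ->; rewrite addr0.
Qed.

Lemma koszul_d_hpart es gs b c s : qh_seq es gs ->
  koszul_d gs (fun t => hpart (b - koszul_wt es t) (c t)) s =
  hpart (b - koszul_wt es s) (koszul_d gs c s).
Proof.
elim: gs es b c s => [|g gs IH] [|e es] b c [|x s] //=; rewrite ?hpart0 //.
move=> [ge gses]; case: x.
- rewrite hpartN; congr (- _).
  have := IH es (b - e) (c \o cons true) s gses.
  rewrite (_ : b - e - _ = b - (e + koszul_wt es s)); last by ring.
  move=> <-; congr (koszul_d _ _ _); apply: funext => t /=; congr (hpart _ _); ring.
- rewrite hpartD (hpartM _ _ ge); congr (_ + _ * hpart _ _); last by ring.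
  have := IH es b (c \o cons false) s gses.
  rewrite add0r => <-; congr (koszul_d _ _ _); apply: funext => t /=.
  by rewrite add0r.
Qed.

(** Vanishing of the first Koszul homology in each internal degree [b], with homogeneous primitives.
    The degree [b] makes a Nakayama induction possible. *)
Definition graded_h1_eq0 (es : seq rat) (gs : seq A) := forall b c, koszul_deg 1 c ->
  (forall s, size s = size gs -> qh (b - koszul_wt es s) (c s)) ->
  (forall s, size s = size gs -> koszul_d gs c s = 0) ->
  exists e, [/\ koszul_deg 2 e,
    forall s, size s = size gs -> qh (b - koszul_wt es s) (e s) &
    forall s, size s = size gs -> c s = koszul_d gs e s].

Lemma koszul_exact_graded es gs : qh_seq es gs ->
  koszul_exact gs (fun p => p = 0) 1 -> graded_h1_eq0 es gs.
Proof.
move=> gses ex b c cdeg cb cycle; have [e edeg eP] := ex c cdeg cycle.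
exists (fun t => hpart (b - koszul_wt es t) (e t)); split=> [s|s _|s ss].
- by move=> /edeg ->; rewrite hpart0.
- exact: qh_hpart.
- rewrite koszul_d_hpart // -(subr0_eq (eP s ss)) hpart_qh //; exact: cb.
Qed.

Lemma koszul_wt_gt0 es s : all (fun e => 0 < e) es -> size s = size es ->
  count id s != 0 -> 0 < koszul_wt es s.
Proof.
have wt_ge0 es' s' : all (fun e => 0 < e) es' -> 0 <= koszul_wt es' s'.
  elim: es' s' => [|e es' IH] [|x s'] //= /andP[e0 /IH IHs'].
  by apply: addr_ge0 => //; case: x => //; exact: ltW.
elim: es s => [|e es IH] [|[] s] //= /andP[e0 es0] [ss]; rewrite ?add0n ?add0r.
  by move=> _; rewrite ltr_wpDr // wt_ge0.
exact: IH.
Qed.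

(* Graded Nakayama: multiplication by g is onto on the first homology of gs. *)
Lemma graded_h1_tail e es g gs : qh_seq (e :: es) (g :: gs) -> size es = size gs ->
  0 < e -> all (fun x => 0 < x) es ->
  graded_h1_eq0 (e :: es) (g :: gs) -> graded_h1_eq0 es gs.
Proof.
move=> [ge gses] ss e0 es0 h1.
(* Each induction step removes a multiple of [g] and so lowers the internal degree by [e]. *)
suff bound j : forall b c, b <= e *+ j -> koszul_deg 1 c ->
    (forall s, size s = size gs -> qh (b - koszul_wt es s) (c s)) ->
    (forall s, size s = size gs -> koszul_d gs c s = 0) ->
    exists f, [/\ koszul_deg 2 f,
      forall s, size s = size gs -> qh (b - koszul_wt es s) (f s) &
      forall s, size s = size gs -> c s = koszul_d gs f s].
  move=> b c; apply: (bound (Num.bound `|b / e|)).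
  rewrite -mulr_natr -ler_pdivrMl // mulrC.
  by rewrite (le_trans (ler_norm _)) // ltW // archi_boundP.
have qhN b p : qh b p -> qh b (- p).
  by have [_ _ /(_ (-1) p)] := qh_subspace b; rewrite scaleN1r.
elim: j => [|j IH] b c bj cdeg cb cycle.
  (* For [b <= 0] a chain of degree 1 has coefficients of negative weighted degree, so it is
     zero. *)
  exists (fun=> 0); split=> [//|s _|s sz]; first exact: qh0.
  rewrite koszul_d0; have [/eqP s1|] := eqVneq (count id s) 1; last by move/cdeg.
  have wt0 : 0 < koszul_wt es s by rewrite koszul_wt_gt0 ?ss // (eqP s1).
  apply/mpolyP => m; rewrite mcoeff0; have /qhE := cb s sz; apply.
  rewrite gt_eqF // (lt_le_trans (y := 0)) //.
    by rewrite mulr0n in bj; rewrite subr_lt0 (le_lt_trans bj).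
  exact: wdeg_ge0.
(* The extension of [c] by zero is a cycle for [g :: gs]. In its primitive [f], the part
   [f \o cons true] is a cycle for [gs] of internal degree [b - e], by induction a boundary
   [koszul_d gs h]; then [c] is the boundary of [f \o cons false] plus [g] times [h]. *)
pose c' s := if s is false :: t then c t else 0.
have [f [fdeg fb fP]] : exists f, [/\ koszul_deg 2 f,
      forall s, size s = size (g :: gs) -> qh (b - koszul_wt (e :: es) s) (f s) &
      forall s, size s = size (g :: gs) -> c' s = koszul_d (g :: gs) f s].
  apply: h1 => [[|[] s] //= sz|[|[] s] //= [sz]|[|[] s] //= [sz]].
  - exact: cdeg.
  - exact: qh0.
  - by rewrite add0r; apply: cb.
  - by rewrite -(koszul_d0 gs s) -[RHS]opprK; congr (- _); rewrite koszul_d0 oppr0.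
  - by rewrite mulr0 addr0; apply: cycle.
have [||s sz|s sz|h [hdeg hb hP]] := IH (b - e) (f \o cons true).
- by rewrite lerBlDr -mulrSr.
- by move=> s sz; apply: fdeg; rewrite /= add1n eqSS.
- by rewrite -addrA -opprD; apply: (fb (true :: s)); rewrite /= sz.
- apply: oppr_inj; rewrite oppr0.
  by have := fP (true :: s); rewrite /= sz => /(_ erefl) <-.
exists (fun s => f (false :: s) + g * h s); split=> [s s2|s sz|s sz].
- by rewrite fdeg ?hdeg ?mulr0 ?addr0.
- have [_ qhD _] := qh_subspace (b - koszul_wt es s); apply: qhD.
    by have := fb (false :: s); rewrite /= sz add0r; apply.
  have := qhM ge (hb s sz); congr (qh _ _); ring.
- rewrite (@koszul_d_comb _ _ (f \o cons false) h 1 g); last by move=> t /=; ring.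
  by rewrite -hP // -[c s]/(c' (false :: s)) fP /= ?sz //; ring.
Qed.

(** A relation placing [g * p] in the ideal of [gs] is a Koszul 1-cycle for [g :: gs] with
    coefficient [p] at [g]. When it bounds, that coefficient lies in the ideal of [gs]. *)
Lemma graded_h1_regular e es g gs b p : qh_seq (e :: es) (g :: gs) ->
  size es = size gs -> graded_h1_eq0 (e :: es) (g :: gs) ->
  qh b p -> in_ideal gs (g * p) -> in_ideal gs p.
Proof.
move=> [ge gses] ss h1 pb gp; have [I0 ID IM] := in_ideal_is_ideal gs.
have [c cdeg cP] : exists2 c, koszul_deg 1 c &
    forall s, size s = size gs -> koszul_d gs c s = if count id s == 0 then - (g * p) else 0.
  by apply: koszul_d_surj; rewrite -mulN1r; apply: IM.
(* Only the part of internal degree [e + b] is kept, so that the graded vanishing applies to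
   [c2]. *)
pose c1 s := hpart (e + b - koszul_wt es s) (c s).
pose c2 s := match s with
  | true :: t => if count id t == 0 then p else 0
  | false :: t => c1 t
  | [::] => 0 end.
have [f [fdeg fb fP]] : exists f, [/\ koszul_deg 2 f,
      forall s, size s = size (g :: gs) -> qh (e + b - koszul_wt (e :: es) s) (f s) &
      forall s, size s = size (g :: gs) -> c2 s = koszul_d (g :: gs) f s].
  apply: h1 => [[|[] s] //=|[|[] s] //= [sz]|[|[] s] //= [sz]].
  - by rewrite add1n eqSS => /negbTE ->.
  - by rewrite add0n => /cdeg cs0; rewrite /c1 cs0 hpart0.
  - case: ifP => [s0|_]; last exact: qh0.
    by rewrite koszul_wt0 // (_ : e + b - _ = b) //; ring.
  - by rewrite add0r; apply: qh_hpart.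
  - rewrite (koszul_d_supp (P := pred1 0)) ?oppr0 // => t /=.
    by move=> /negbTE ->.
  - rewrite (_ : _ \o _ = c1) // koszul_d_hpart // cP //.
    case: ifP => [s0|_]; last by rewrite hpart0 mulr0 addr0.
    rewrite koszul_wt0 // subr0 hpartN (hpartM _ _ ge) (_ : e + b - e = b).
    + by rewrite (hpart_qh pb) addNr.
    + by ring.
have := fP (true :: nseq (size gs) false); rewrite /= size_nseq count_nseq mul0n eqxx.
by move=> -> //; rewrite -mulN1r; apply: IM; apply: in_ideal_koszul_d.
Qed.
End Graded.

(** * Hilbert functions *)

Section Powers.
Variables (C : numFieldType) (n N : nat).
Local Notation A := (mpoly n C).
Implicit Types (p q : A) (m : multi_index n) (i : 'I_n).

(* The monomial ideal (x_0^N, ..., x_(k-1)^N). *)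
Definition power_ideal k p : Prop := forall m, mcoeff m p != 0 ->
  exists2 i : 'I_n, (i < k)%N & (N <= m i)%N.

Local Notation pow i := (mpolyX C (mnm_muln (mnm1 i) N)).

Lemma mnm_powE i (j : 'I_n) : (mnm_muln (mnm1 i) N) j = (N * (i == j))%N.
Proof. by rewrite mulmnE mnm1E mulnC. Qed.

Lemma power_idealD k p q : power_ideal k p -> power_ideal k q -> power_ideal k (p + q).
Proof.
move=> pk qk m; rewrite mcoeffD => pqm.
have [p0|/pk//] := eqVneq (mcoeff m p) 0.
by apply: qk; rewrite p0 add0r in pqm.
Qed.

Lemma power_ideal0 k : power_ideal k 0.
Proof. by move=> m; rewrite mcoeff0 eqxx. Qed.

Lemma power_ideal_sum k (I : Type) (r : seq I) (P : pred I) (F : I -> A) :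
  (forall x, P x -> power_ideal k (F x)) -> power_ideal k (\sum_(i <- r | P i) F i).
Proof.
move=> FP; elim/big_ind: _ => //; [exact: power_ideal0|exact: power_idealD].
Qed.

Lemma power_ideal_is_ideal k : is_ideal (power_ideal k).
Proof.
split; [exact: power_ideal0|exact: power_idealD|move=> p q qk].
rewrite [q]mpolyE mulr_sumr big_seq; apply: power_ideal_sum => m.
rewrite mcoeff_msupp => /qk[i ik Ni].
rewrite [p]mpolyE mulr_suml; apply: power_ideal_sum => m' _ l.
rewrite -scalerAl -scalerAr !mcoeffZ -mpolyXD mcoeffX.
case: (eqVneq (mnm_add m' m) l) => [<- _|_]; last by rewrite !mulr0 eqxx.
by exists i; rewrite // mnmDE (leq_trans Ni) // leq_addl.
Qed.

Lemma power_idealS i p :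
  power_ideal i.+1 p <-> exists q, power_ideal i (p - pow i * q).
Proof.
split=> [pi|[q pq] m pm].
  (* The monomials of [p] divisible by [x_i^N], divided by it. *)
  pose q := \sum_(m <- msupp p | (N <= m i)%N)
    mcoeff m p *: mpolyX C (mnm_sub m (mnm_muln (mnm1 i) N)).
  exists q; have -> : pow i * q = \sum_(m <- msupp p | (N <= m i)%N) mcoeff m p *: mpolyX C m.
    rewrite mulr_sumr; apply: eq_bigr => m Nm; rewrite -scalerAr -mpolyXD.
    congr (_ *: mpolyX C _).
    apply/mnmP => j; rewrite mnmDE mnmBE mnm_powE subnKC //.
    by case: eqP => [<-|_]; rewrite ?muln1 ?muln0.
  rewrite [X in X - _]mpolyE (bigID (fun m : multi_index n => (N <= m i)%N)) /= addrC addrK.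
  rewrite big_seq_cond; apply: power_ideal_sum => m /andP[].
  rewrite mcoeff_msupp => /pi[j ji Nj] Nm l.
  rewrite mcoeffZ mcoeffX; case: (eqVneq m l) => [<- _|_]; last by rewrite mulr0 eqxx.
  exists j => //; rewrite ltn_neqAle -ltnS ji andbT.
  by apply: contra Nm => /eqP/val_inj <-.
have [pq0|/pq[j ji Nj]] := eqVneq (mcoeff m (p - pow i * q)) 0; last first.
  by exists j => //; exact: ltnW.
have : mcoeff m (pow i * q) != 0.
  by move: pq0; rewrite mcoeffB => /eqP; rewrite subr_eq0 => /eqP <-.
rewrite [q]mpolyE mulr_sumr raddf_sum /= => qm.
have [l lm] : exists l, mnm_add (mnm_muln (mnm1 i) N) l = m.
  apply: contrapT => nl; move/eqP: qm; apply; apply: big1 => l _.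
  rewrite -scalerAr mcoeffZ -mpolyXD mcoeffX; case: eqP => [lm|_]; rewrite ?mulr0 //.
  by case: nl; exists l.
by exists i => //; rewrite -lm mnmDE mnm_powE eqxx muln1 leq_addr.
Qed.

Lemma power_ideal_regular i p : power_ideal i (pow i * p) -> power_ideal i p.
Proof.
move=> zp m pm; have [|j ji] := zp (mnm_add (mnm_muln (mnm1 i) N) m).
  by rewrite mulrC mcoeffMX.
rewrite mnmDE mnm_powE; case: eqP => [ij|_]; first by rewrite ij ltnn in ji.
by rewrite muln0; exists j.
Qed.

(** The powers [x_i^N] form a regular sequence of length [n] inside the ideal of [gs]. Starting
    modulo all of them in degree [n + 1], [koszul_exact_quotient] removes one power and lowers the
    degree by one, until degree 1 modulo zero. *)
Lemma koszul_exact_powers gs : size gs = n ->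
  (forall i, in_ideal gs (pow i)) -> koszul_exact gs (fun p => p = 0) 1.
Proof.
move=> sgs gsP.
suff ex k : (k <= n)%N -> koszul_exact gs (power_ideal (n - k)) (n - k).+1.
  have := ex n (leqnn n); rewrite subnn => {}ex c cdeg cycle.
  have I0 p : power_ideal 0 p -> p = 0.
    move=> p0; apply/mpolyP => m; rewrite mcoeff0; apply/eqP.
    by apply: contraT => /p0[].
  have [s ss|e edeg eP] := ex c cdeg; first by rewrite cycle //; exact: power_ideal0.
  by exists e => // s ss; apply/I0/eP.
elim: k => [|k IH] kn.
  (* A list of [n] bits has at most [n] entries [true], so a chain of degree [n + 1] vanishes
     there. *)
  rewrite subn0 => c cdeg _; exists (fun=> 0) => // s ss.
  rewrite koszul_d0 subr0 cdeg; first exact: power_ideal0.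
  by rewrite neq_ltn ltnS -sgs -ss count_size.
have kn' : (n - k.+1 < n)%N by lia.
have -> : (n - k.+1)%N = Ordinal kn' by [].
have /in_ideal_lincomb[bs sbs zE] := gsP (Ordinal kn').
apply: (koszul_exact_quotient (power_ideal_is_ideal _) sbs zE).
- exact: power_ideal_regular.
- exact: power_idealS.
- have := IH (ltnW kn); rewrite (_ : (n - k)%N = (Ordinal kn').+1) //=; lia.
Qed.

End Powers.

(* Multiplies the series sum_b F(b) t^b by prod_(e <- es) (1 - t^e). *)
Fixpoint bdiff (es : seq rat) (F : rat -> rat) (b : rat) : rat :=
  if es is e :: es' then bdiff es' F b - bdiff es' F (b - e) else F b.

Lemma eq_bdiff es F G b : F =1 G -> bdiff es F b = bdiff es G b.
Proof. by move=> FG; elim: es b => //= e es IH b; rewrite !IH. Qed.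

Lemma bdiff_subshift es F e b :
  bdiff es (fun x => F x - F (x - e)) b = bdiff es F b - bdiff es F (b - e).
Proof.
elim: es b => //= e' es IH b; rewrite !IH (_ : b - e - e' = b - e' - e); ring.
Qed.

Lemma bdiffC es es' F b : bdiff es (bdiff es' F) b = bdiff es' (bdiff es F) b.
Proof.
elim: es b => [|e es IH] b; first by apply: eq_bdiff => x.
by rewrite [LHS]/= !IH -bdiff_subshift; apply: eq_bdiff.
Qed.

Lemma in_ideal_map (A : comNzRingType) (I : eqType) (r : seq I) (G : I -> A) p :
  uniq r -> in_ideal [seq G i | i <- r] p <-> exists h, p = \sum_(i <- r) h i * G i.
Proof.
elim: r p => [|j r IH] p /=.
  by move=> _; split=> [->|[h ->]]; [exists (fun=> 0)|]; rewrite big_nil.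
move=> /andP[jr /IH{}IH]; split=> [[q /IH[h hE]]|[h ->]].
  exists (fun i => if i == j then q else h i); rewrite big_cons eqxx.
  rewrite (_ : \sum_(i <- r) _ = p - G j * q); first by ring.
  rewrite hE big_seq [RHS]big_seq; apply: eq_bigr => i ir.
  by case: eqP => // ij; rewrite -ij ir in jr.
by exists (h j); apply/IH; exists h; rewrite big_cons; ring.
Qed.

(** * Hilbert functions of homogeneous complete intersections *)

Section Hilbert.
Variables (C : numFieldType) (n : nat) (w : 'I_n -> rat).
Hypothesis w_gt0 : forall i, 0 < w i.
Local Notation A := (mpoly n C).
Local Notation qh := (quasihomogeneous w).
Local Notation wdeg := (weighted_degree w).

(** The weights have a positive lower bound, so a fixed weighted degree bounds the ordinary degree
    and leaves finitely many monomials. *)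
Lemma qh_finite_dim b : exists d, has_dim_mod [set p : A | qh b p] [set p | p = 0] d.
Proof.
have [e e0 ew] : exists2 e : rat, 0 < e & forall i, e <= w i.
  case: n w w_gt0 => [|k] u u0; first by exists 1 => // -[].
  exists (\big[Order.min/u ord0]_i u i).
    by elim/big_ind: _ => // x y x0 y0; rewrite lt_min x0.
  by move=> i; rewrite (bigD1 i) //= ge_min lexx.
have wdeg_ge m : e * (mdeg m)%:R <= wdeg m.
  rewrite mdegE natr_sum mulr_sumr; apply: ler_sum => i _.
  by rewrite ler_wpM2r // ler0n.
pose N := Num.bound `|b / e|.
have mdeg_lt m : wdeg m = b -> (mdeg m < N)%N.
  move=> mb; rewrite -(ltr_nat rat); apply: le_lt_trans (archi_boundP (normr_ge0 _)).
  by apply: le_trans (ler_norm _); rewrite ler_pdivlMr // mulrC -mb.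
pose I := {m : bmultinom n N | wdeg m == b}.
exists #|{: I}|; exists (fun k => mpolyX C (bmnm (val (enum_val k)))); split.
- move=> k /= m /qhX ->; exact/eqP/(valP (enum_val k)).
- move=> c /= /mpolyP c0 k; have := c0 (bmnm (val (enum_val k))).
  rewrite mcoeff0 raddf_sum (bigD1 k) //= mcoeffZ mcoeffX eqxx mulr1 big1 ?addr0 // => j jk.
  rewrite mcoeffZ mcoeffX; case: eqP => [|_]; last by rewrite mulr0.
  by move=> /val_inj/val_inj/enum_val_inj ejk; rewrite ejk eqxx in jk.
- move=> p /= pb; exists (fun k => mcoeff (bmnm (val (enum_val k))) p).
  apply/mpolyP => m; rewrite mcoeff0 mcoeffB raddf_sum /=.
  under eq_bigr do rewrite mcoeffZ mcoeffX.
  have [mb|mb] := eqVneq (wdeg m) b; last first.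
    rewrite ((qhE _ _ _).1 pb m mb) sub0r big1 ?oppr0 // => k _.
    case: eqP => [km|_]; last by rewrite mulr0.
    by move: mb; rewrite -km => /negP[]; apply: valP (enum_val k).
  have mbb : wdeg (BMultinom (mdeg_lt m mb)) == b by apply/eqP.
  pose k := enum_rank (exist _ (BMultinom (mdeg_lt m mb)) mbb : I).
  have kE : bmnm (val (enum_val k)) = m by rewrite enum_rankK.
  rewrite (bigD1 k) //= kE eqxx mulr1 big1 ?addr0 ?subrr // => j jk.
  case: eqP => [|_]; last by rewrite mulr0.
  by rewrite -kE => /val_inj/val_inj/enum_val_inj ejk; rewrite ejk eqxx in jk.
Qed.

Lemma ideal_subspace gs : is_subspace [set p : A | in_ideal gs p].
Proof.
have [I0 ID IM] := in_ideal_is_ideal gs.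
by split=> //= k p gp; rewrite -mul_mpolyC; apply: IM.
Qed.

(** Multiplication by [g] on the quotient by [gs] is injective on homogeneous elements and has the
    quotient by [g :: gs] as cokernel. So each generator of degree [e] contributes a factor 1 - t^e
    to the Hilbert series. *)
Lemma hilbert_regular (h0 : rat -> nat) es gs :
  (forall b, has_dim_mod [set p : A | qh b p] [set p | p = 0] (h0 b)) ->
  size es = size gs -> qh_seq w es gs -> all (fun e => 0 < e) es ->
  graded_h1_eq0 w es gs ->
  forall b, exists2 d, has_dim_mod [set p : A | qh b p] [set p | in_ideal gs p] d &
    d%:R = bdiff es (fun b => (h0 b)%:R) b.
Proof.
move=> h0P; elim: gs es => [|g gs IH] [|e es] //=; first by move=> _ _ _ _ b; exists (h0 b).
move=> [ss] [ge gses] /andP[e0 es0] h1 b.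
have tail := graded_h1_tail w_gt0 (conj ge gses) ss e0 es0 h1.
have [d dP dE] := IH es ss gses es0 tail b.
have [d' d'P d'E] := IH es ss gses es0 tail (b - e).
have [I0 ID IM] := in_ideal_is_ideal gs.
have linT : linear ( *%R g) by move=> k p q /=; rewrite mulrDr scalerAr.
pose T : {linear A -> A} := HB.pack ( *%R g) (GRing.isLinear.Build _ _ _ _ ( *%R g) linT).
have [v vb|v vb|v vb|k kP kE] := @has_dim_mod_coker C A
  [set p | qh (b - e) p] [set p | in_ideal gs p]
  [set p | qh b p] [set p | in_ideal gs p] [set p | in_ideal (g :: gs) p]
  T d' d (@qh_subspace C n w (b - e)) (ideal_subspace gs)
  (@qh_subspace C n w b) _ _ _ d'P dP.
- by rewrite /T /= -(subrKC e b); apply: qhM.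
- split=> /= [|/(IM g)//].
  exact: (graded_h1_regular (conj ge gses) ss h1 vb).
- split=> /= [[q vq]|[q qb vq]]; last by exists q.
  exists (hpart w (b - e) q); first exact: qh_hpart.
  by rewrite -(hpartM _ _ ge) -[X in X - _](hpart_qh vb) -hpartN -hpartD; apply: (hpart_ideal _ gses).
- by exists k => //; rewrite -dE -d'E -kE natrD addrC addKr.
Qed.

Lemma hilbert_power (h0 : rat -> nat) N es gs :
  (forall b, has_dim_mod [set p : A | qh b p] [set p | p = 0] (h0 b)) ->
  size gs = n -> size es = n -> qh_seq w es gs -> all (fun e => 0 < e) es ->
  (forall i, in_ideal gs (mpolyX C (mnm_muln (mnm1 i) N))) ->
  forall b d, has_dim_mod [set p : A | qh b p] [set p | in_ideal gs p] d ->
    d%:R = bdiff es (fun b => (h0 b)%:R) b.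
Proof.
move=> h0P sgs ses gses es0 gsN b d dP.
have ss : size es = size gs by rewrite ses.
have h1 := koszul_exact_graded gses (koszul_exact_powers sgs gsN).
have [d' d'P <-] := hilbert_regular h0P ss gses es0 h1 b.
by rewrite (has_dim_mod_inj (ideal_subspace gs) (@qh_subspace C n w b) dP d'P).
Qed.

Definition var_seq : seq A := [seq mpolyX C (mnm1 i) | i <- enum 'I_n].

Lemma in_ideal_vars p : in_ideal var_seq p <-> mcoeff mnm0 p = 0.
Proof.
split=> [/(in_ideal_map _ _ (enum_uniq _))[h ->]|p0].
  rewrite raddf_sum big1 //= => i _; rewrite mcoeffM.
  rewrite big1 // => -[k l] /= /eqP kl; rewrite mcoeffX.
  case: eqP => [il|_]; last by rewrite mulr0.
  have := congr1 (fun m : multi_index n => m i) kl.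
  by rewrite mnmDE mnm0E -il mnm1E eqxx addn1.
have [I0 ID IM] := in_ideal_is_ideal var_seq.
rewrite [p]mpolyE big_seq; elim/big_ind: _ => // m; rewrite mcoeff_msupp => pm.
have [i mi] : exists i, m i != 0%N.
  apply: contrapT => m0; case/eqP: pm; rewrite -p0; congr mcoeff.
  apply/mnmP => i; rewrite mnm0E; apply/eqP/negPn/negP => mi.
  by apply: m0; exists i.
rewrite -mul_mpolyC; apply: (IM); apply/in_ideal_map; first exact: enum_uniq.
exists (fun j => if j == i then mpolyX C (mnm_sub m (mnm1 i)) else 0).
rewrite (bigD1_seq i) ?mem_enum ?enum_uniq //= eqxx big1 ?addr0 => [|j /negbTE ->].
  rewrite -mpolyXD submK //; apply/mnm_lepP => j; rewrite mnm1E.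
  by case: eqP => [<-|//]; rewrite lt0n.
by rewrite mul0r.
Qed.

(** The quotient by the variables is [C] in degree 0. This makes 1 the product of the Hilbert series
    of the polynomial ring with all 1 - t^(w_i). *)
Lemma hilbert_vars b :
  has_dim_mod [set p : A | qh b p] [set p | in_ideal var_seq p] (b == 0).
Proof.
have wdeg0 : wdeg mnm0 = 0 by rewrite /weighted_degree big1 // => i _; rewrite mnm0E mulr0.
case: eqP => [->|/eqP b0]; last first.
  exists (fun=> 0); split=> [i /=|c _ []//|v /qhE vb]; first exact: qh0.
  by exists (fun=> 0); rewrite big_ord0 subr0; apply/in_ideal_vars/vb; rewrite wdeg0 eq_sym.
exists (fun=> 1); split=> [i /=|c|v /qhE vb].
- by rewrite -mpolyX0 -[X in qh X]wdeg0; apply: qhX.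
- rewrite big_ord1 /= => /in_ideal_vars; rewrite mcoeffZ mcoeff1 eqxx mulr1 => c0 i.
  by rewrite (ord1 i).
- exists (fun=> mcoeff mnm0 v); rewrite big_ord1; apply/in_ideal_vars.
  by rewrite mcoeffB mcoeffZ mcoeff1 eqxx mulr1 subrr.
Qed.

Lemma qh_seq_map (I : Type) (r : seq I) (e : I -> rat) (G : I -> A) :
  (forall i, qh (e i) (G i)) -> qh_seq w (map e r) (map G r).
Proof. by move=> GP; elim: r. Qed.

(** The Hilbert function [h0] of the polynomial ring is eliminated between the formulas for [G] and
    for the variables, since difference operators commute. *)
Lemma hilbert_complete_intersection (N : nat) (e : 'I_n -> rat) (G : 'I_n -> A)
    (H : rat -> nat) :
  (forall i, 0 < e i) -> (forall i, qh (e i) (G i)) ->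
  (forall i, exists h, mpolyX C (mnm_muln (mnm1 i) N) = \sum_j h j * G j) ->
  (forall b, has_dim_mod [set p : A | qh b p]
    [set p | exists h, p = \sum_j h j * G j] (H b)) ->
  forall b, bdiff [seq w i | i <- enum 'I_n] (fun x => (H x)%:R) b =
    bdiff [seq e i | i <- enum 'I_n] (fun x => (x == 0)%:R) b.
Proof.
move=> e0 GP GN HP b.
have idG p : in_ideal [seq G i | i <- enum 'I_n] p <-> exists h, p = \sum_j h j * G j.
  rewrite in_ideal_map ?enum_uniq //.
  by split=> -[h ->]; exists h; rewrite big_enum.
have /choice[h0 h0P] := qh_finite_dim.
have pos (u : 'I_n -> rat) : (forall i, 0 < u i) -> all (fun x => 0 < x) [seq u i | i <- enum 'I_n].
  by move=> u0; apply/allP => _ /mapP[i _ ->].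
have sz (T : Type) (u : 'I_n -> T) : size [seq u i | i <- enum 'I_n] = n.
  by rewrite size_map size_enum_ord.
have HE x : (H x)%:R = bdiff [seq e i | i <- enum 'I_n] (fun b => (h0 b)%:R) x.
  apply: (hilbert_power (N := N) h0P (sz _ G) (sz _ e) (qh_seq_map _ GP) (pos _ e0)) => [i|].
    exact/idG/GN.
  apply: eq_has_dim_mod (HP x) => [|v _]; [exact: qh_subspace|]. move: (idG v) => /=; tauto.
have vE x : ((x == 0) : nat)%:R = bdiff [seq w i | i <- enum 'I_n] (fun b => (h0 b)%:R) x.
  apply: (hilbert_power (N := 1) h0P (sz _ _) (sz _ w) (qh_seq_map _ _) (pos _ w_gt0)) => [i|i|].
  - by rewrite -(wdeg_mnm1 w i); exact: qhX.
  - apply/in_ideal_vars; rewrite mcoeffX; case: eqP => // /mnmP/(_ i).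
    by rewrite mulmnE mnm1E eqxx mnm0E.
  - exact: hilbert_vars.
rewrite (eq_bdiff _ _ HE) [RHS](eq_bdiff _ _ vE); exact: bdiffC.
Qed.

End Hilbert.

(** * Generating function identities *)

Section Duality.
Implicit Types (es : seq rat) (F : rat -> rat).

(** Pairs (coefficient, exponent) of the expanded product of the 1 - t^e, equal exponents not
    collected. *)
Fixpoint bdiff_terms es : seq (rat * rat) :=
  if es is e :: es' then
    bdiff_terms es' ++ [seq (- x.1, x.2 + e) | x <- bdiff_terms es']
  else [:: (1, 0)].

Lemma bdiffE es F b : bdiff es F b = \sum_(x <- bdiff_terms es) x.1 * F (b - x.2).
Proof.
elim: es b => [|e es IH] b /=; first by rewrite big_seq1 mul1r subr0.
rewrite big_cat big_map /= !IH -sumrN; congr (_ + _).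
by apply: eq_bigr => x _; rewrite mulNr (_ : b - e - x.2 = b - (x.2 + e)) //; ring.
Qed.

Lemma bdiffNE es F b :
  bdiff (map -%R es) F b = \sum_(x <- bdiff_terms es) x.1 * F (b + x.2).
Proof.
elim: es b => [|e es IH] b /=; first by rewrite big_seq1 mul1r addr0.
rewrite big_cat big_map /= !IH -sumrN; congr (_ + _).
by apply: eq_bigr => x _; rewrite mulNr (_ : b - - e + x.2 = b + (x.2 + e)) //; ring.
Qed.

(* [bdiff (map -%R es)] is the transpose of [bdiff es] for the pairing
   sum_b F(b) G(b), and the left-hand side pairs the hypothesis with [F]. *)
Lemma bdiff_dual ws ds (s : seq rat) :
  (forall b, bdiff ws (fun x => (count_mem x s)%:R) b =
             bdiff ds (fun x => (x == 0)%:R) b) ->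
  forall F, \sum_(b <- s) bdiff (map -%R ws) F b = bdiff (map -%R ds) F 0.
Proof.
move=> wd F.
(* A finite set containing every point at which [F] is evaluated; it replaces the sum over all
   rationals. *)
pose U := undup ([seq b + x.2 | b <- s, x <- bdiff_terms ws] ++
                 [seq x.2 | x <- bdiff_terms ds]).
have FE v : v \in U -> F v = \sum_(u <- U) (u == v)%:R * F u.
  move=> vU; rewrite (bigD1_seq v) ?undup_uniq //= eqxx mul1r big1 ?addr0 // => u /negbTE ->.
  by rewrite mul0r.
have countE (y : rat) : (count_mem y s)%:R = \sum_(b <- s) (b == y)%:R :> rat.
  by rewrite -sum1_count natr_sum big_mkcond; apply: eq_bigr => b _ /=; case: eqP.
transitivity (\sum_(u <- U) bdiff ws (fun x => (count_mem x s)%:R) u * F u).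
  under eq_bigr do rewrite bdiffNE.
  under [RHS]eq_bigr do rewrite bdiffE mulr_suml.
  rewrite exchange_big [RHS]exchange_big big_seq [RHS]big_seq.
  apply: eq_bigr => x xw /=; under [RHS]eq_bigr do rewrite countE mulr_sumr mulr_suml.
  rewrite [RHS]exchange_big big_seq [RHS]big_seq; apply: eq_bigr => b bs /=.
  rewrite FE ?mulr_sumr; last first.
    by rewrite mem_undup mem_cat; apply/orP; left; apply/allpairsP; exists (b, x).
  by apply: eq_bigr => u _; rewrite mulrA -subr_eq eq_sym.
under eq_bigr do rewrite wd bdiffE mulr_suml.
rewrite bdiffNE exchange_big big_seq [RHS]big_seq; apply: eq_bigr => x xd /=.
rewrite add0r FE ?mulr_sumr; last first.
  by rewrite mem_undup mem_cat; apply/orP; right; apply/mapP; exists x.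
by apply: eq_bigr => u _; rewrite mulrA subr_eq0.
Qed.

(** The operator evaluates at [b] plus subsums of [es]; only the empty subsum can reach a point
    [c <= b]. *)
Lemma bdiffN_indic_le es b c : all (fun e => 0 < e) es -> c <= b ->
  bdiff (map -%R es) (fun x => (x == c)%:R) b = (b == c)%:R.
Proof.
elim: es b => [|e es IH] b //= /andP[e0 es0] cb; rewrite !IH //; last lra.
rewrite [X in _ - X](_ : _ = 0) ?subr0 //.
by case: eqP => // bc; lra.
Qed.

(** Here only the full subsum can reach [c], and it carries the sign of all factors. *)
Lemma bdiffN_indic_ge es b c : all (fun e => 0 < e) es ->
  b + \sum_(e <- es) e <= c ->
  bdiff (map -%R es) (fun x => (x == c)%:R) b =
  (-1) ^+ size es * (b + \sum_(e <- es) e == c)%:R.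
Proof.
elim: es b => [|e es IH] b /=; first by rewrite big_nil addr0 expr0 mul1r.
move=> /andP[e0 es0]; rewrite big_cons => bc.
rewrite !IH // ?opprK; [|lra|lra].
rewrite (_ : (b + _ == c) = false); last by apply/eqP; lra.
by rewrite mulr0 sub0r exprS mulN1r mulNr addrA.
Qed.

End Duality.

(* Test against the indicators of the extreme points of both sides: nothing can
   cancel there. *)
Lemma bdiff_dual_extremes ws ds (s : seq rat) (lo hi : rat) :
  all (fun e => 0 < e) ws -> all (fun e => 0 < e) ds ->
  (forall F, \sum_(b <- s) bdiff (map -%R ws) F b = bdiff (map -%R ds) F 0) ->
  lo \in s -> hi \in s -> (forall b, b \in s -> lo <= b <= hi) ->
  lo = 0 /\ hi = \sum_(e <- ds) e - \sum_(e <- ws) e.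
Proof.
move=> w0 d0 dual los his lohi.
have countE (c : rat) : \sum_(b <- s) (b == c)%:R = (count_mem c s)%:R :> rat.
  by rewrite -sum1_count natr_sum [RHS]big_mkcond; apply: eq_bigr => b _ /=; case: eqP.
have lo_dual (c : rat) : c <= lo -> c <= 0 -> (count_mem c s)%:R = (0 == c)%:R :> rat.
  move=> clo c0; rewrite -(bdiffN_indic_le d0 c0) -dual -countE.
  apply: eq_big_seq => b /lohi/andP[lob _]; rewrite bdiffN_indic_le //; exact: le_trans lob.
have hi_dual (c : rat) : hi <= c - \sum_(e <- ws) e -> \sum_(e <- ds) e <= c ->
    (-1) ^+ size ws * (count_mem (c - \sum_(e <- ws) e) s)%:R =
    (-1) ^+ size ds * (\sum_(e <- ds) e == c)%:R :> rat.
  move=> chi cd; rewrite -countE mulr_sumr.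
  etransitivity; [|etransitivity; [exact: (dual (fun x => (x == c)%:R))|]].
    apply: eq_big_seq => b /lohi/andP[_ bhi].
    by rewrite bdiffN_indic_ge ?[b == _]eq_sym ?subr_eq 1?[c == _]eq_sym //; lra.
  by rewrite bdiffN_indic_ge ?add0r.
have count_gt0 (c : rat) : c \in s -> (count_mem c s)%:R != 0 :> rat.
  by move=> cs; rewrite pnatr_eq0 -lt0n -has_count has_pred1.
have count_eq0 (c : rat) : (forall b, b \in s -> b != c) -> (count_mem c s)%:R = 0 :> rat.
  by move=> sc; rewrite (count_memPn _) //; apply/negP => /sc/eqP.
(* A negative [lo] is refuted by the test at [lo], a positive one by the test at 0. For [hi] the
   tests are at the sum of [ds] if it is too small and at [hi] plus the sum of [ws] if it is too
   large. *)
split.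
  have [lo0|lo0|//] := ltgtP lo 0.
    have := count_gt0 lo los; rewrite lo_dual ?(ltW lo0) //.
    by rewrite [0 == lo]gt_eqF // mulr0n eqxx.
  have := lo_dual 0 (ltW lo0) (lexx _); rewrite eqxx count_eq0.
    by move/eqP; rewrite eq_sym oner_eq0.
  by move=> b /lohi/andP[lob _]; rewrite gt_eqF // (lt_le_trans lo0).
have s1 k : (-1) ^+ k != 0 :> rat by rewrite signr_eq0.
have [hi0|hi0|//] := ltgtP hi (\sum_(e <- ds) e - \sum_(e <- ws) e).
  have := hi_dual (\sum_(e <- ds) e); rewrite eqxx count_eq0 ?lexx ?(ltW hi0) //.
    by move=> /(_ isT isT)/eqP; rewrite mulr0 mulr1 eq_sym (negbTE (s1 _)).
  by move=> b /lohi/andP[_ bhi]; rewrite lt_eqF // (le_lt_trans bhi).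
have := hi_dual (hi + \sum_(e <- ws) e); rewrite addrK lexx -lerBlDr (ltW hi0).
move=> /(_ isT isT)/eqP; rewrite [_ == hi + _]lt_eqF; last by rewrite -ltrBlDr.
by rewrite mulr0 mulf_eq0 (negbTE (s1 _)) (negbTE (count_gt0 _ his)).
Qed.

(** * Central differences and the second moment *)

Section CentralDifferences.
Implicit Types (b c e : rat) (es ws ds s : seq rat) (p : {poly rat}).

(** The central difference p(X + e/2) - p(X - e/2) through Taylor's formula, in which only odd
    orders survive; [N] is meant to bound the size of [p]. *)
Definition cdiff (N : nat) (e : rat) (p : {poly rat}) : {poly rat} :=
  \sum_(i < N) ((e / 2) ^+ i - (- (e / 2)) ^+ i) *: p^`N(i).

Lemma horner_cdiff N e p x : (size p <= N)%N ->
  (cdiff N e p).[x] = p.[x + e / 2] - p.[x - e / 2].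
Proof.
move=> pN; rewrite !(nderiv_taylor_wide (mulrC _ _) pN).
rewrite -sumrB horner_sum; apply: eq_bigr => i _.
by rewrite hornerZ mulrC mulrBr.
Qed.

Lemma coef_cdiff N e p k : (cdiff N e p)`_k =
  \sum_(i < N) ((e / 2) ^+ i - (- (e / 2)) ^+ i) * (p`_(i + k) *+ 'C(i + k, i)).
Proof. by rewrite coef_sum; apply: eq_bigr => i _; rewrite coefZ coef_nderivn. Qed.

(** Orders 0 and 2 cancel, and orders from 4 on involve coefficients beyond the size of [p]. *)
Lemma coef_cdiff4 m e p k : (size p <= m.+4)%N -> (m <= k)%N ->
  (cdiff m.+4 e p)`_k = e * (k.+1)%:R * p`_k.+1 +
    e ^+ 3 / 4 * ('C(k.+3, 3))%:R * p`_k.+3.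
Proof.
move=> pm mk; rewrite coef_cdiff.
rewrite -(big_mkord xpredT (fun i =>
  ((e / 2) ^+ i - (- (e / 2)) ^+ i) * (p`_(i + k) *+ 'C(i + k, i)))).
rewrite (big_cat_nat (n := 4)) //= [X in _ + X]big1_seq ?addr0; last first.
  move=> i /andP[_]; rewrite mem_index_iota => /andP[i4 _].
  by rewrite nth_default ?mul0rn ?mulr0 // (leq_trans pm) // -addn4 addnC leq_add.
rewrite !big_nat_recr ?big_geq //= !add1n !add0n bin0 bin1.
have sumE (x a0 a1 a2 a3 : rat) : 0 + (x ^+ 0 - (- x) ^+ 0) * a0 +
    (x ^+ 1 - (- x) ^+ 1) * a1 + (x ^+ 2 - (- x) ^+ 2) * a2 +
    (x ^+ 3 - (- x) ^+ 3) * a3 = 2 * x * a1 + 2 * x ^+ 3 * a3 by ring.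
rewrite sumE -[p`_k.+1 *+ _]mulr_natr -[_ *+ 'C(_, _)]mulr_natr.
move: (k.+1%:R) ('C(k.+3, 3)%:R) => u v; rewrite -[(3 + k)%N]/k.+3; by field.
Qed.

(* prod_e 2 sinh(e D / 2) = prod_e (e D) * (1 + (sum_e e^2) D^2 / 24 + ...), where
   D = d/dx; the terms of higher order kill [p]. *)
Lemma bdiffN_poly es p c b : (size p <= (size es).+3)%N ->
  let m := size es in let y := b + c + (\sum_(e <- es) e) / 2 in
  bdiff (map -%R es) (fun x => p.[x + c]) b =
  (-1) ^+ m * (\prod_(e <- es) e) *
   (p`_m.+2 * (m.+2)`!%:R * (y ^+ 2 / 2 + (\sum_(e <- es) e ^+ 2) / 24) +
    p`_m.+1 * (m.+1)`!%:R * y + p`_m * m`!%:R).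
Proof.
elim: es p c => [|e es IH] p c /= sp.
  rewrite !big_nil (horner_coef_wide _ sp) !big_ord_recr big_ord0 /=.
  rewrite -[0`!]/1%N -[1`!]/1%N -[2`!]/2%N.
  by move: p`_0 p`_1 p`_2 => *; field.
have sq : (size (cdiff (size es).+4 (- e) p) <= (size es).+3)%N.
  apply/leq_sizeP => k mk; rewrite coef_cdiff4 //; last lia.
  by rewrite !nth_default ?mulr0 ?mulr0 ?addr0 //; apply: (leq_trans sp); lia.
rewrite -bdiff_subshift; set F := fun _ => _.
(* The half step [e / 2] moves into the shift [c], which turns the one-sided difference into a
   central one. *)
have FE : F =1 fun x => (cdiff (size es).+4 (- e) p).[x + (c + e / 2)].
  by move=> x; rewrite /F horner_cdiff // opprK; congr (p.[_] - p.[_]); field.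
rewrite (eq_bdiff _ _ FE); apply: (etrans (IH _ _ sq)).
rewrite !coef_cdiff4 // ?leqW //.
rewrite [p`_(size es).+4](nth_default _ sp) [p`_(size es).+4.+1]nth_default; last exact: leqW.
set m := size es; rewrite !big_cons.
have -> : b + (c + e / 2) + (\sum_(e <- es) e) / 2 =
  b + c + (e + \sum_(e <- es) e) / 2 by field.
move: (b + c + _) (\sum_(e <- es) e ^+ 2) (\prod_(e <- es) e) => y S E.
have f1 : m.+1%:R * m`!%:R = (m.+1)`!%:R :> rat by rewrite -natrM.
have f2 : m.+2%:R * (m.+1)`!%:R = (m.+2)`!%:R :> rat by rewrite -natrM.
have f3 : m.+3%:R * (m.+2)`!%:R = (m.+3)`!%:R :> rat by rewrite -natrM.
(* The factor 1/6 turns [e ^+ 3 / 4] into [e] times [e ^+ 2 / 24], the contribution of [e] to the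
   quadratic term. *)
have f4 : 'C(m.+3, 3)%:R * m`!%:R = (m.+3)`!%:R / 6 :> rat.
  have := @bin_fact m.+3 3 isT; rewrite !subSS subn0 -[3`!]/6%N => <-.
  by rewrite !natrM; move: (m`!%:R) ('C(_, _)%:R) => *; field.
rewrite [(-1) ^+ m.+1]exprS.
transitivity ((-1) ^+ m * E * (- e * (m.+3%:R * (m.+2)`!%:R) * p`_m.+3 * (y ^+ 2 / 2 + S / 24) +
   - e * (m.+2%:R * (m.+1)`!%:R) * p`_m.+2 * y +
   (- e * (m.+1%:R * m`!%:R) * p`_m.+1 - e ^+ 3 / 4 * ('C(m.+3, 3)%:R * m`!%:R) * p`_m.+3))).
  move: (m`!%:R) ((m.+1)`!%:R) ((m.+2)`!%:R) (m.+1%:R) (m.+2%:R) (m.+3%:R) ('C(m.+3, 3)%:R)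
    ((-1) ^+ m) (p`_m.+1) (p`_m.+2) (p`_m.+3) => *; by field.
rewrite f1 f2 f3 f4.
move: ((m.+1)`!%:R) ((m.+2)`!%:R) ((m.+3)`!%:R)
    ((-1) ^+ m) (p`_m.+1) (p`_m.+2) (p`_m.+3) => *; by field.
Qed.

(* Test against (x + c)^m and (x + c)^(m+2), with m = size ws. *)
Lemma bdiff_dual_variance ws ds (s : seq rat) : size ws = size ds ->
  all (fun e => 0 < e) ws ->
  (forall F, \sum_(b <- s) bdiff (map -%R ws) F b = bdiff (map -%R ds) F 0) ->
  \sum_(b <- s) (b - (\sum_(e <- ds) e - \sum_(e <- ws) e) / 2) ^+ 2 =
  (size s)%:R * (\sum_(e <- ds) e ^+ 2 - \sum_(e <- ws) e ^+ 2) / 12.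
Proof.
move=> ss w0 dual; set m := size ws.
(* This shift kills the centred argument on the side of [ds] and produces the required centre on the
   side of [ws]. *)
pose c := - (\sum_(e <- ds) e) / 2.
have Ew0 : \prod_(e <- ws) e != 0.
  by rewrite prodf_seq_neq0; apply/allP => e /(allP w0); rewrite lt0r => /andP[].
have fact0 k : k`!%:R != 0 :> rat by rewrite pnatr_eq0 -lt0n fact_gt0.
have dualX k : (k < m.+3)%N ->
    \sum_(b <- s) (-1) ^+ m * (\prod_(e <- ws) e) *
      (('X^k)`_m.+2 * (m.+2)`!%:R *
          ((b + c + (\sum_(e <- ws) e) / 2) ^+ 2 / 2 + (\sum_(e <- ws) e ^+ 2) / 24) +
       ('X^k)`_m.+1 * (m.+1)`!%:R * (b + c + (\sum_(e <- ws) e) / 2) + ('X^k)`_m * m`!%:R) =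
    (-1) ^+ m * (\prod_(e <- ds) e) *
      (('X^k)`_m.+2 * (m.+2)`!%:R *
          ((0 + c + (\sum_(e <- ds) e) / 2) ^+ 2 / 2 + (\sum_(e <- ds) e ^+ 2) / 24) +
       ('X^k)`_m.+1 * (m.+1)`!%:R * (0 + c + (\sum_(e <- ds) e) / 2) + ('X^k)`_m * m`!%:R).
  move=> km; apply: etrans (etrans (dual (fun x => ('X^k).[x + c])) _).
    by apply: eq_bigr => b _; apply/esym/bdiffN_poly; rewrite size_polyXn.
  by rewrite /m ss; apply: bdiffN_poly; rewrite size_polyXn -ss.
have s1 k : (-1) ^+ k != 0 :> rat by rewrite signr_eq0.
have n1 : (m.+1 == m) = false by apply/eqP; lia.
have n2 : (m.+2 == m) = false by apply/eqP; lia.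
have n3 : (m.+1 == m.+2) = false by apply/eqP; lia.
have n4 : (m == m.+2) = false by apply/eqP; lia.
have size_sum (x : rat) : \sum_(b <- s) x = (size s)%:R * x.
  by rewrite big_const_seq count_predT iter_addr_0 mulr_natl.
set Ew := \prod_(e <- ws) e in Ew0 dualX; set Ed := \prod_(e <- ds) e in dualX.
set Sw := \sum_(e <- ws) e ^+ 2 in dualX *; set Sd := \sum_(e <- ds) e ^+ 2 in dualX *.
(* The test with exponent [m] sees only the leading terms of the two operators. *)
have muE : (size s)%:R * Ew = Ed.
  have := dualX m (leqW (leqW (ltnSn _))).
  rewrite !coefXn eqxx n1 n2 ![false%:R]mulr0n ![true%:R]mulr1n => H.
  have {}H : \sum_(b <- s) (-1) ^+ m * Ew * m`!%:R = (-1) ^+ m * Ed * m`!%:R.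
    etransitivity; [|etransitivity; [exact: H|by ring]].
    by apply: eq_bigr => b _; ring.
  apply: (mulfI (s1 m)); apply: (mulIf (fact0 m)).
  by rewrite -H size_sum; ring.
have := dualX m.+2 (ltnSn _).
rewrite !coefXn eqxx n3 n4 ![false%:R]mulr0n ![true%:R]mulr1n => H.
have : \sum_(b <- s) ((b - (\sum_(e <- ds) e - \sum_(e <- ws) e) / 2) ^+ 2 / 2 + Sw / 24)
    = (size s)%:R * (Sd / 24).
  apply: (mulfI (s1 m)); apply: (mulfI Ew0); apply: (mulIf (fact0 m.+2)).
  rewrite !mulr_sumr mulr_suml.
  etransitivity; [|etransitivity; [exact: H|by rewrite -muE /c; field]].
  by apply: eq_bigr => b _; rewrite /c; field.
rewrite big_split size_sum /= -mulr_suml.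
move: (\sum_(b <- s) _) => V H3; lra.
Qed.
End CentralDifferences.

(** * Germs of power series *)

Lemma near0_box (C : numFieldType) n (P : 'rV[C]_n -> Prop) :
  (\forall z \near (0 : 'rV[C]_n), P z) ->
  exists2 d : C, 0 < d & forall z : 'rV[C]_n, (forall i, `|z 0 i| < d) -> P z.
Proof.
move=> /nbhs_ballP[d /= d0 dP]; exists d => // z zd; apply: dP; split=> // i j.
by rewrite ord1 mxE /ball /= sub0r normrN.
Qed.

Local Open Scope classical_set_scope.

Section PowerSeries.
Variables (C : numFieldType) (q : nat -> C).
Hypothesis q_cvg0 : forall x : C, 0 < x -> x <= 1 ->
  (fun K => \sum_(0 <= k < K) q k * x ^+ k) @ \oo --> (0 : C).

Let sum_small (x e : C) : 0 < x -> x <= 1 -> 0 < e ->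
  exists K0, forall K, (K0 <= K)%N -> `|\sum_(0 <= k < K) q k * x ^+ k| < e.
Proof.
move=> x0 x1 e0; have /cvgrPdist_lt/(_ e e0)[K0 _ K0P] := q_cvg0 x0 x1.
by exists K0 => K /K0P /=; rewrite sub0r normrN.
Qed.

(** At x = 1 late partial sums have norm below 1, so a late coefficient, a difference of two of
    them, has norm at most 2; the finitely many others are added to the bound. *)
Let q_bounded : exists2 B : C, 0 < B & forall k, `|q k| <= B.
Proof.
have [K0 K0P] := sum_small ltr01 (lexx 1) ltr01.
exists (2 + \sum_(k < K0) `|q k|).
  by rewrite ltr_pwDl // sumr_ge0.
move=> k; have [kK|Kk] := ltnP k K0.
  rewrite (bigD1 (Ordinal kK)) //= addrCA lerDl addr_ge0 // sumr_ge0 // => i _.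
rewrite ler_wpDr ?sumr_ge0 //.
have -> : q k = \sum_(0 <= j < k.+1) q j * 1 ^+ j - \sum_(0 <= j < k) q j * 1 ^+ j.
  by rewrite big_nat_recr //= expr1n mulr1 addrAC subrr add0r.
rewrite (le_trans (ler_normB _ _)) // (_ : 2 = 1 + 1) //.
by apply: lerD; apply/ltW/K0P => //; apply: leqW.
Qed.

(** At the first nonzero coefficient, a suitable [x] makes its term too large for the tail to
    cancel. *)
Lemma power_series_eq0 k : q k = 0.
Proof.
have [B B0 qB] := q_bounded.
elim/ltn_ind: k => k IH; apply/eqP; apply: contraT => qk0.
set e := `|q k|; have e0 : 0 < e by rewrite normr_gt0.
have eB0 : 0 < e + 2 * B by rewrite addr_gt0 // mulr_gt0.
(* Chosen so that [x * (B / (1 - x)) = e / 2]: the tail is then at most half of the term of index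
   [k]. *)
pose x := e / (e + 2 * B).
have x0 : 0 < x by rewrite divr_gt0.
have x1 : 1 - x = 2 * B / (e + 2 * B).
  by rewrite /x; field; exact: lt0r_neq0.
have x1_gt0 : 0 < 1 - x by rewrite x1 divr_gt0 // mulr_gt0.
have tail N : `|\sum_(0 <= j < N) q (k.+1 + j)%N * x ^+ j| <= B / (1 - x) * (1 - x ^+ N).
  elim: N => [|N IHN]; first by rewrite big_geq // normr0 expr0 subrr mulr0.
  rewrite big_nat_recr //= (le_trans (ler_normD _ _)) //.
  rewrite (_ : B / (1 - x) * (1 - x ^+ N.+1) = B / (1 - x) * (1 - x ^+ N) + B * x ^+ N).
    apply: lerD => //; rewrite normrM normrX (gtr0_norm x0).
    by rewrite ler_wpM2r // exprn_ge0 // ltW.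
  by rewrite exprS; field; exact: lt0r_neq0.
have xle1 : x <= 1 by rewrite -subr_ge0 ltW.
have [|K0 K0P] := @sum_small x (x ^+ k * (e / 2)) x0 xle1.
  by rewrite mulr_gt0 ?exprn_gt0 // divr_gt0.
have := K0P (k.+1 + K0)%N (leq_addl _ _).
rewrite (big_cat_nat _ (n := k.+1)) ?leq_addr //= big_nat_recr //=.
rewrite [X in X + _ + _]big1_seq ?add0r; last first.
  by move=> j /andP[_]; rewrite mem_index_iota => /IH ->; rewrite mul0r.
rewrite -{1}[k.+1]add0n big_addn addKn.
under eq_bigr do rewrite addnC exprD mulrCA.
rewrite -mulr_sumr; set R := \sum_(_ <= _ < _) _ => small.
have RB : `|x ^+ k.+1 * R| <= x ^+ k * (e / 2).
  rewrite normrM normrX (gtr0_norm x0) exprSr -mulrA.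
  rewrite ler_wpM2l ?exprn_ge0 ?(ltW x0) //.
  rewrite (_ : e / 2 = x * (B / (1 - x))); last first.
    by rewrite x1 /x; field; rewrite !lt0r_neq0.
  rewrite ler_wpM2l ?(ltW x0) // (le_trans (tail _)) // ler_piMr //.
    by rewrite divr_ge0 ?ltW.
  by rewrite gerBl exprn_ge0 // ltW.
have qE : `|q k * x ^+ k| = x ^+ k * (e / 2) + x ^+ k * (e / 2).
  by rewrite normrM normrX (gtr0_norm x0) -/e; field.
suff : `|q k * x ^+ k| < x ^+ k * (e / 2) + x ^+ k * (e / 2) by rewrite qE ltxx.
rewrite -[q k * x ^+ k](addrK (x ^+ k.+1 * R)) (le_lt_trans (ler_normB _ _)) //.
exact: ltr_leD.
Qed.

End PowerSeries.

(** * The weighted torus action on polynomials *)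

Section Torus.
Variables (C : numFieldType) (n : nat) (V : 'I_n -> nat).
Local Notation A := (mpoly n C).
Implicit Types (p q : A) (x : C) (z : 'rV[C]_n) (m : multi_index n).

Definition vdeg m : nat := \sum_(i < n) V i * m i.

Lemma weighted_degree_nat m :
  weighted_degree (fun i => (V i)%:R) m = (vdeg m)%:R.
Proof. by rewrite natr_sum; apply: eq_bigr => i _; rewrite natrM. Qed.

Definition vpart k p : A := hpart (fun i => (V i)%:R) k%:R p.

Lemma mcoeff_vpart k p m :
  mcoeff m (vpart k p) = if vdeg m == k then mcoeff m p else 0.
Proof. by rewrite mcoeff_hpart weighted_degree_nat eqr_nat. Qed.

Definition torus x z : 'rV[C]_n := \row_i (x ^+ V i * z 0 i).

Lemma monomial_torus m x z : monomial m (torus x z) = x ^+ vdeg m * monomial m z.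
Proof.
rewrite /monomial /vdeg expr_sum -big_split; apply: eq_bigr => i _ /=.
by rewrite mxE exprMn exprM.
Qed.

Lemma poly_funE p z : poly_fun p z = \sum_(m <- msupp p) mcoeff m p * monomial m z.
Proof. exact: mevalE. Qed.

Lemma poly_fun_torus k p x z : (forall m, m \in msupp p -> vdeg m = k) ->
  poly_fun p (torus x z) = x ^+ k * poly_fun p z.
Proof.
move=> pk; rewrite !poly_funE mulr_sumr; apply: eq_big_seq => m /pk mk.
by rewrite monomial_torus mk mulrCA.
Qed.

Lemma poly_fun_vpart_torus k p x z :
  poly_fun (vpart k p) (torus x z) = x ^+ k * poly_fun (vpart k p) z.
Proof.
apply: poly_fun_torus => m; rewrite mcoeff_msupp mcoeff_vpart.
by case: ifP => [/eqP//|_]; rewrite eqxx.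
Qed.

Lemma torus_box x z d : 0 < x -> x <= 1 -> (forall i, `|z 0 i| < d) ->
  forall i, `|torus x z 0 i| < d.
Proof.
move=> x0 x1 zd i; rewrite mxE normrM normrX (gtr0_norm x0).
by rewrite (le_lt_trans _ (zd i)) // ler_piMl // exprn_ile1 // ltW.
Qed.

Lemma vpart_sum K p : (forall m, m \in msupp p -> (vdeg m < K)%N) ->
  p = \sum_(0 <= k < K) vpart k p.
Proof.
move=> pK; apply/mpolyP => m; rewrite raddf_sum /= big_mkord.
under eq_bigr do rewrite mcoeff_vpart.
have [mp|mp] := boolP (m \in msupp p); last first.
  by rewrite memN_msupp_eq0 // big1 // => i _; rewrite if_same.
rewrite (bigD1 (Ordinal (pK m mp))) //= eqxx big1 ?addr0 // => i /eqP im.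
by case: ifP => // /eqP mi; case: im; apply: val_inj.
Qed.

Lemma vdeg_bounded p : exists K, forall m, m \in msupp p -> (vdeg m < K)%N.
Proof.
exists (\max_(m <- msupp p) (vdeg m).+1)%N => m mp.
by rewrite (big_rem m) //= leq_max leqnn.
Qed.

Lemma poly_fun_sum (I : Type) (r : seq I) (P : pred I) (F : I -> A) z :
  poly_fun (\sum_(i <- r | P i) F i) z = \sum_(i <- r | P i) poly_fun (F i) z.
Proof. exact: raddf_sum. Qed.

(** Along the orbit of [z] the function is a polynomial in [x] that vanishes on (0, 1], and its
    coefficients are the values of the components at [z]. *)
Lemma box_vpart d p : (forall z, (forall i, `|z 0 i| < d) -> poly_fun p z = 0) ->
  forall k z, (forall i, `|z 0 i| < d) -> poly_fun (vpart k p) z = 0.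
Proof.
move=> p0 k z zd; apply: (@power_series_eq0 C (fun k => poly_fun (vpart k p) z)).
move=> x x_gt0 x1; apply: cvg_near_cst; have [K pK] := vdeg_bounded p.
exists K => // K' /= KK'; rewrite -[RHS](p0 (torus x z)); last exact: torus_box.
rewrite [in RHS](@vpart_sum K' p) => [|m /pK mK]; last exact: leq_trans KK'.
rewrite poly_fun_sum; apply: eq_bigr => j _.
by rewrite poly_fun_vpart_torus mulrC.
Qed.

End Torus.

(** Taking components in one variable after another, with an indicator as weight, isolates a single
    monomial, which is nonzero at the point with all coordinates [d / 2]. *)
Lemma box_eq0 (C : numFieldType) n (p : mpoly n C) (d : C) : 0 < d ->
  (forall z : 'rV[C]_n, (forall i, `|z 0 i| < d) -> poly_fun p z = 0) -> p = 0.
Proof.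
move=> d0 p0; apply/mpolyP => m; rewrite mcoeff0.
pose part (i : 'I_n) (r : mpoly n C) := vpart (fun j => (j == i) : nat) (m i) r.
have vdegE (i : 'I_n) (k : multi_index n) : vdeg (fun j => (j == i) : nat) k = k i.
  rewrite /vdeg (bigD1 i) //= eqxx mul1n big1 ?addn0 // => j /negbTE ->.
  by rewrite mul0n.
pose pm := foldr part p (enum 'I_n).
have pm0 (z : 'rV[C]_n) : (forall i, `|z 0 i| < d) -> poly_fun pm z = 0.
  by rewrite /pm; elim: (enum _) z => //= i r IH z; apply: box_vpart.
have coef_pm k : mcoeff k pm = if k == m then mcoeff m p else 0.
  have -> : mcoeff k pm = if all (fun i => k i == m i) (enum 'I_n) then mcoeff k p else 0.
    rewrite /pm; elim: (enum _) => //= i r IH; rewrite mcoeff_vpart vdegE IH.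
    by case: eqP.
  have [->|km] := eqVneq k m; first by rewrite (introT allP) // => i _; exact: eqxx.
  case: allP => // mk; case/eqP: km; apply/mnmP => i; apply/eqP/mk.
  by rewrite mem_enum.
pose z : 'rV[C]_n := const_mx (d / 2).
have := pm0 z; rewrite (_ : pm = mcoeff m p *: mpolyX C m); last first.
  apply/mpolyP => k; rewrite coef_pm mcoeffZ mcoeffX eq_sym.
  by case: eqP => [->|]; rewrite ?mulr1 ?mulr0.
rewrite /poly_fun mevalZ mevalX => H.
have /eqP : mcoeff m p * \prod_(i < n) z 0 i ^+ m i = 0.
  apply: H => i; rewrite mxE gtr0_norm ?divr_gt0 //.
  by rewrite ltr_pdivrMr // ltr_pMr // ltr1n.
rewrite mulf_eq0 => /orP[/eqP//|/prodf_eq0[i _]].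
by rewrite mxE expf_eq0 mulf_eq0 invr_eq0 pnatr_eq0 (gt_eqF d0) andbF.
Qed.

(** * Homogeneous components of convergent power series *)

Section Jets.
Variables (C : numFieldType) (n : nat) (V : 'I_n -> nat).
Hypothesis V_gt0 : forall i, (0 < V i)%N.
Local Notation A := (mpoly n C).
Local Notation vdeg := (vdeg V).
Implicit Types (p q : A) (x : C) (z : 'rV[C]_n) (m : multi_index n)
  (a : multi_index n -> C).

Lemma mdeg_le_vdeg m : (mdeg m <= vdeg m)%N.
Proof. by rewrite mdegE; apply: leq_sum => i _; rewrite leq_pmull. Qed.

Definition vdeg_lt K : {fset multi_index n} :=
  seq_fset tt [seq m <- [seq bmnm b | b <- enum {: bmultinom n K}] | (vdeg m < K)%N].

Lemma in_vdeg_lt K m : (m \in vdeg_lt K) = (vdeg m < K)%N.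
Proof.
rewrite seq_fsetE mem_filter andb_idr // => mK.
have mK' := leq_ltn_trans (mdeg_le_vdeg m) mK.
by apply/mapP; exists (BMultinom mK'); rewrite ?mem_enum.
Qed.

(** Cofinality of these sets turns unconditional summation into the limit of a sequence. *)
Lemma vdeg_lt_cvg : vdeg_lt K @[K --> \oo] --> totally.
Proof.
move=> B [S _ SB]; exists (\max_(m <- S) (vdeg m).+1)%N => // K /= SK.
apply: SB => /=; apply/fsubsetP => m mS; rewrite in_vdeg_lt.
by apply: leq_trans SK; rewrite (big_rem m) //= leq_max leqnn.
Qed.

Definition jet a k : A :=
  \sum_(m <- vdeg_lt k.+1 | vdeg m == k) a m *: mpolyX C m.

Lemma vdeg_jet a k m : m \in msupp (jet a k) -> vdeg m = k.
Proof.
rewrite mcoeff_msupp; apply: contra_neq_eq => mk; rewrite raddf_sum /= big1 // => j /eqP jk.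
rewrite mcoeffZ mcoeffX; case: eqP => [jm|_]; last by rewrite mulr0.
by rewrite -jm jk eqxx in mk.
Qed.

Lemma partial_sum_jet a z K :
  partial_sum (fun m => a m * monomial m z) (vdeg_lt K) =
  \sum_(0 <= k < K) poly_fun (jet a k) z.
Proof.
rewrite /partial_sum -(big_seq_fsetE _ (vdeg_lt K) xpredT (fun m => a m * monomial m z)) /=.
have jetE k : (k < K)%N -> poly_fun (jet a k) z =
    \sum_(m <- vdeg_lt K) if vdeg m == k then a m * monomial m z else 0.
  move=> kK; rewrite -big_mkcond poly_fun_sum -[LHS]big_filter -[RHS]big_filter.
  rewrite [LHS](perm_big [seq m <- vdeg_lt K | vdeg m == k]).
    by apply: eq_bigr => m _; rewrite /poly_fun mevalZ mevalX.
  apply: uniq_perm; rewrite ?filter_uniq ?fset_uniq // => m.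
  rewrite !mem_filter !in_vdeg_lt; case: eqP => //= ->.
  by rewrite ltnSn kK.
rewrite big_mkord; under [RHS]eq_bigr => k _ do rewrite jetE //.
rewrite exchange_big; apply: eq_big_seq => m /=; rewrite in_vdeg_lt => mK.
rewrite (bigD1 (Ordinal mK)) //= eqxx big1 ?addr0 // => k /eqP km.
by case: ifP => // /eqP mk; case: km; apply: val_inj.
Qed.

Lemma analytic_jet_cvg (g : 'rV[C]_n -> C) : analytic_at g 0 ->
  exists a, exists2 d : C, 0 < d & forall z, (forall i, `|z 0 i| < d) ->
    forall x, 0 < x -> x <= 1 ->
    (fun K => \sum_(0 <= k < K) poly_fun (jet a k) z * x ^+ k) @ \oo
      --> g (torus V x z).
Proof.
move=> [a /near0_box[d d0 ad]]; exists a, d => // z zd x x0 x1.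
have := ad _ (torus_box V x0 x1 zd).
rewrite subr0 => /(cvg_comp _ _ vdeg_lt_cvg).
apply: cvg_trans; apply: near_eq_cvg; apply: nearW => K /=.
rewrite partial_sum_jet; apply: eq_bigr => k _.
by rewrite (poly_fun_torus _ _ (@vdeg_jet a k)) mulrC.
Qed.

(** On the orbit of a point [z] both sides become power series in [x]. Comparing coefficients of x^b
    expresses [p] through the components of degree [b - e i] of the [h i], which are polynomials. *)
Lemma qh_germ_ideal (I : finType) (G : I -> A) (e : I -> nat) p b
    (h : I -> 'rV[C]_n -> C) :
  (forall i m, m \in msupp (G i) -> vdeg m = e i) ->
  (forall m, m \in msupp p -> vdeg m = b) ->
  (forall i, analytic_at (h i) 0) ->
  (\forall z \near (0 : 'rV[C]_n), poly_fun p z = \sum_i h i z * poly_fun (G i) z) ->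
  exists Q : I -> A, p = \sum_i Q i * G i.
Proof.
move=> Ge pb han /near0_box[d0 d0_gt0 pE].
have /choice[a /= aP] := fun i => analytic_jet_cvg (han i).
have /choice[d dP] : forall i, exists d : C, 0 < d /\ forall z, (forall i, `|z 0 i| < d) ->
    forall x, 0 < x -> x <= 1 ->
    (fun K => \sum_(0 <= k < K) poly_fun (jet (a i) k) z * x ^+ k) @ \oo
      --> h i (torus V x z).
  by move=> i; have [d] := aP i; exists d.
have d_gt0 i : 0 < d i by case: (dP i).
(* The inverse of [S] lies below all the radii and replaces a minimum, the order of [C] being
   partial. *)
pose S := d0^-1 + \sum_i (d i)^-1.
have S0 : 0 < S by rewrite ltr_pwDl ?invr_gt0 // sumr_ge0 // => i _; rewrite invr_ge0 ltW.
have S_le_d0 : S^-1 <= d0.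
  by rewrite invf_ple ?posrE // lerDl sumr_ge0 // => i _; rewrite invr_ge0 ltW.
have S_le_d i : S^-1 <= d i.
  rewrite invf_ple ?posrE // /S (bigD1 i) //= addrCA lerDl addr_ge0 ?invr_ge0 ?(ltW d0_gt0) //.
  by apply: sumr_ge0 => j _; rewrite invr_ge0 ltW.
(* The coefficient of x^k in [x ^+ e i] times [h i] along the orbit. *)
pose c i k := if (e i <= k)%N then jet (a i) (k - e i) else 0.
exists (fun i => c i b); apply/subr0_eq/(@box_eq0 C n _ S^-1); rewrite ?invr_gt0 // => z zS.
pose s k := \sum_i poly_fun (c i k) z * poly_fun (G i) z - (if k == b then poly_fun p z else 0).
have s0 : forall k, s k = 0.
  apply: power_series_eq0 => x x0 x1.
  pose l := \sum_i x ^+ e i * h i (torus V x z) * poly_fun (G i) z - x ^+ b * poly_fun p z.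
  have l0 : l = 0.
    have td : forall i, `|torus V x z 0 i| < d0.
      by apply: torus_box => // i; exact: lt_le_trans (zS i) S_le_d0.
    have := pE _ td; rewrite /l (poly_fun_torus _ _ pb) => ->.
    apply/eqP; rewrite subr_eq0; apply/eqP; apply: eq_bigr => i _.
    by rewrite (poly_fun_torus _ _ (Ge i)); ring.
  suff : (fun K => \sum_(0 <= k < K) s k * x ^+ k) @ \oo --> l by rewrite l0.
  have sE K : \sum_(0 <= k < K) s k * x ^+ k =
      \sum_i (\sum_(0 <= k < K) poly_fun (c i k) z * x ^+ k) * poly_fun (G i) z -
      (if (b < K)%N then x ^+ b * poly_fun p z else 0).
    rewrite /s; under eq_bigr do rewrite mulrBl mulr_suml.
    rewrite sumrB exchange_big; congr (_ - _).
      by apply: eq_bigr => i _; rewrite mulr_suml; apply: eq_bigr => k _; rewrite mulrAC.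
    rewrite big_mkord; case: ltnP => bK.
      rewrite (bigD1 (Ordinal bK)) //= eqxx big1 ?addr0 1?mulrC // => k /eqP kb.
      by case: eqP => [kb'|]; rewrite ?mul0r //; case: kb; apply: val_inj.
    by rewrite big1 // => k _; rewrite ltn_eqF ?mul0r // (leq_trans (ltn_ord k)).
under eq_cvg do rewrite sE.
  apply: cvgB; last first.
    by apply: cvg_near_cst; exists b.+1 => // K /= bK; rewrite bK.
  apply: cvg_big => [|i _]; first exact: add_continuous.
  apply: cvgMr_tmp; rewrite -(cvg_shiftn (e i)) /=.
  have cE K : \sum_(0 <= k < K + e i) poly_fun (c i k) z * x ^+ k =
      x ^+ e i * \sum_(0 <= k < K) poly_fun (jet (a i) k) z * x ^+ k.
    rewrite (big_cat_nat _ (n := e i)) ?leq_addl //= big1_seq ?add0r; last first.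
      move=> k /andP[_]; rewrite mem_index_iota => /= ke.
      by rewrite /c leqNgt ke /poly_fun meval0 mul0r.
    rewrite -{1}[e i]add0n big_addn addnK mulr_sumr; apply: eq_bigr => k _.
    by rewrite /c leq_addl addnK exprD; ring.
  under eq_cvg do rewrite cE.
  apply: cvgMl_tmp; apply: (dP i).2 => // j.
  exact: lt_le_trans (zS j) (S_le_d i).
have := s0 b; rewrite /s eqxx => /subr0_eq sb.
rewrite /poly_fun mevalB -!/(poly_fun _ _) -sb poly_fun_sum.
apply/eqP; rewrite subr_eq0; apply/eqP; apply: eq_bigr => i _.
by rewrite /poly_fun mevalM.
Qed.

End Jets.

(** The expansion at [c] is the translated polynomial; its partial sums are constant once they
    contain the support. *)
Lemma holomorphic_poly_fun (C : numFieldType) n (p : mpoly n C) :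
  holomorphic_germ (poly_fun p).
Proof.
near=> c.
pose p' := comp_mpoly [tuple mpolyX C (mnm1 i) + mpolyC n (c 0 i) | i < n] p.
exists (fun m => mcoeff m p'); near=> z.
have -> : poly_fun p z = poly_fun p' (z - c).
  rewrite /poly_fun comp_mpoly_meval; apply: meval_eq => i.
  by rewrite tnth_mktuple mevalD mevalXU mevalC !mxE subrK.
have FF := @filter_filter _ _ (@totally_filter (multi_index n)).
apply: (@cvg_near_cst _ _ _ _ _ FF); exists (seq_fset tt (msupp p')) => // S /= /fsubsetP pS.
rewrite /partial_sum -(big_seq_fsetE _ S xpredT (fun m => mcoeff m p' * monomial m (z - c))) /=.
rewrite poly_funE (bigID (fun m => m \in msupp p')) /= [X in _ + X]big1 ?addr0; last first.
  by move=> m /memN_msupp_eq0 ->; rewrite mul0r.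
rewrite -big_filter; apply: perm_big; apply: uniq_perm => [||m].
- by rewrite filter_uniq ?fset_uniq.
- exact: msupp_uniq.
- rewrite mem_filter andb_idr // => mp; have := pS m; apply.
  by move: mp; rewrite -(seq_fsetE tt).
Unshelve. all: by end_near. Qed.

(** Clearing denominators makes the exponents of the torus action natural numbers. *)
Lemma rat_common_denom (I : finType) (w : I -> rat) : (forall i, 0 < w i) ->
  exists D : nat, exists2 V : I -> nat, (0 < D)%N &
    forall i, (V i)%:R = D%:R * w i.
Proof.
move=> w0; pose D := (\prod_i `|denq (w i)|)%N.
exists D; exists (fun i => (`|numq (w i)| * \prod_(j | j != i) `|denq (w j)|)%N).
  rewrite /D; elim/big_ind: _ => // [x y x0 y0|i _]; rewrite ?muln_gt0 ?x0 //.
  by rewrite absz_gt0 denq_neq0.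
move=> i; have -> : D = (`|denq (w i)| * \prod_(j | j != i) `|denq (w j)|)%N.
  by rewrite /D (bigD1 i).
rewrite [LHS]natrM [X in _ = X * _]natrM mulrAC; congr (_ * _).
rewrite !natr_absz gtr0_norm ?numq_gt0 // gtr0_norm ?denq_gt0 //.
by rewrite -{3}[w i]divq_num_den mulrCA divff ?mulr1 // intr_eq0 denq_neq0.
Qed.

(** * The Jacobi ideal: from germs to polynomials *)

Section Jacobi.
Variables (C : numFieldType) (n : nat) (w : 'I_n -> rat).
Hypothesis w_gt0 : forall i, 0 < w i.
Hypothesis w_le1 : forall i, w i <= 1.
Local Notation A := (mpoly n C).
Implicit Types (f p : A) (b : rat).

Lemma qh_mderiv f b i : quasihomogeneous w b f ->
  quasihomogeneous w (b - w i) (mderiv i f).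
Proof.
move=> /qhE fb; apply/qhE => m mb; rewrite mcoeff_deriv fb ?mul0rn //.
by apply: contra_neq mb => <-; rewrite wdegD wdeg_mnm1 addrK.
Qed.

Lemma jacobi_ideal_qh f p b : quasihomogeneous w 1 f -> quasihomogeneous w b p ->
  jacobi_ideal f (poly_fun p) <-> exists Q, p = \sum_i Q i * mderiv i f.
Proof.
move=> f1 pb; split=> [[h hhol hE]|[Q ->]]; last first.
  exists (fun i => poly_fun (Q i)) => [i|]; first exact: holomorphic_poly_fun.
  near=> z; rewrite poly_fun_sum; apply: eq_bigr => i _.
  by rewrite /poly_fun mevalM.
have [D [V D0 VE]] := rat_common_denom w_gt0.
have vdegE m : (vdeg V m)%:R = D%:R * weighted_degree w m.
  rewrite natr_sum mulr_sumr; apply: eq_bigr => i _.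
  by rewrite natrM VE mulrA.
have V0 i : (0 < V i)%N by rewrite -(ltr0n rat) VE mulr_gt0 // ltr0n.
have VD i : (V i <= D)%N.
  by rewrite -(ler_nat rat) VE ler_piMr.
(* A nonzero [p] has a monomial [m0], which makes [D * b] a natural number. *)
have [->|p0] := eqVneq p 0.
  by exists (fun=> 0); rewrite big1 // => i _; rewrite mul0r.
have [m0 m0p] : exists m0, m0 \in msupp p.
  by exists (mlead p); rewrite mlead_supp.
apply: (@qh_germ_ideal C n V V0 _ _ (fun i => D - V i)%N p (vdeg V m0) h).
- move=> i m mf; have mi := @qh_mderiv f 1 i f1 m mf.
  apply/eqP; rewrite -(eqr_nat rat) vdegE natrB // VE mi.
  by apply/eqP; ring.
- move=> m mp; apply/eqP; rewrite -(eqr_nat rat) !vdegE.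
  by rewrite (pb _ mp) (pb _ m0p).
- by move=> i; have := hhol i => /nbhs_singleton.
- exact: hE.
Unshelve. all: by end_near. Qed.

Lemma has_graded_dim_poly f b d : quasihomogeneous w 1 f ->
  has_graded_dim w f b d ->
  has_dim_mod [set p : A | quasihomogeneous w b p]
    [set p | exists Q, p = \sum_i Q i * mderiv i f] d.
Proof.
move=> f1 [e [/= We indep span]].
have /choice[q qP] : forall i, exists p, quasihomogeneous w b p /\ e i = poly_fun p.
  by move=> i; have [p pb pE] := We i; exists p.
have qb i : quasihomogeneous w b (q i) by case: (qP i).
have comb (c : 'I_d -> C) : \sum_i c i *: e i = poly_fun (\sum_i c i *: q i) :> ('rV[C]_n -> C^o).
  apply: funext => z; rewrite fct_sumE poly_fun_sum; apply: eq_bigr => i _.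
  by rewrite (qP i).2 /poly_fun mevalZ.
have combb (c : 'I_d -> C) : quasihomogeneous w b (\sum_i c i *: q i).
  exact: (subspace_comb (@qh_subspace C n w b) c qb).
exists q; split=> //= [c|p pb].
  move=> /(jacobi_ideal_qh f1 (combb c)) cJ; apply: indep.
  by rewrite comb.
have [|c cJ] := span (poly_fun p); first by exists p.
exists c; apply/(jacobi_ideal_qh f1).
  exact: (subspaceB (@qh_subspace C n w b) pb (combb c)).
move: cJ; rewrite comb; congr (jacobi_ideal f _); apply: funext => z.
by rewrite /poly_fun mevalB.
Qed.

End Jacobi.

(* The variables are x_0, ..., x_n, whence the n.+1; alpha_i is alpha`_(i - 1). *)
Theorem theorem1p1 (R : realType) (n : nat) (w : 'I_n.+1 -> rat)
    (f : mpoly.mpoly n.+1 (Cplx R)) (mu : nat) (alpha : mu.-tuple rat)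
    (w_range : forall i, 0 < w i <= 2^-1)
    (f_qh : quasihomogeneous w 1 f)
    (f_isol : isolated_singularity f)
    (mu_milnor : has_milnor_number f mu)
    (alpha_spec : is_spectrum w f alpha) :
  mu%:R^-1 * \sum_(i < mu) (alpha`_i - (n%:R - 1) / 2) ^+ 2
    = (alpha`_mu.-1 - alpha`_0) / 12.
Proof.
have w0 i : 0 < w i by case/andP: (w_range i).
have w1 i : w i <= 1 by case/andP: (w_range i) => _ wi; lra.
have e0 i : 0 < 1 - w i by case/andP: (w_range i) => _ wi; lra.
have [sorted_alpha dims] := alpha_spec.
set a1 := -1 + \sum_i w i in dims *.
have [mu0|mu_gt0] := posnP mu.
  (* Both sides vanish: the sum is empty and entries out of range default to 0. *)
  have a0 k : alpha`_k = 0 by rewrite nth_default // size_tuple mu0.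
  by rewrite !a0 subrr mul0r big1 ?mulr0 // => i; have := ltn_ord i; lia.
pose s := [seq a - a1 | a <- alpha].
have dimE b : has_dim_mod [set p | quasihomogeneous w b p]
    [set p | exists Q, p = \sum_i Q i * mderiv i f] (count_mem b s).
  apply: has_graded_dim_poly => //.
  have := dims (b + a1); rewrite addrK count_map; congr (has_graded_dim _ _ _ _).
  by apply: eq_count => a /=; rewrite subr_eq.
have [N NP] : exists N, forall i, exists h,
    mpolyX (Cplx R) (mnm_muln (mnm1 i) N) = \sum_j h j * mderiv j f.
  (* No degree above [M] occurs in [s], so there the Jacobi algebra is zero and large powers of each
     variable lie in the ideal. *)
  pose M := \sum_(b <- s) `|b|.
  have M0 : 0 <= M by apply: sumr_ge0.
  exists (\max_i Num.bound (M / w i))%N => i; set N := (\max_i _)%N.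
  set m := mnm_muln _ _.
  have wm : M < weighted_degree w m.
    have -> : weighted_degree w m = N%:R * w i.
      rewrite -(wdeg_mnm1 w i) /weighted_degree mulr_sumr; apply: eq_bigr => j _.
      by rewrite mulmnE natrM; ring.
    rewrite -ltr_pdivrMr //.
    apply: lt_le_trans (archi_boundP (divr_ge0 M0 (ltW (w0 i)))) _.
    by rewrite ler_nat; apply: (leq_bigmax i).
  have := dimE (weighted_degree w m); rewrite (count_memPn _) => [[e [_ _ span]]|].
    have [|c [h hE]] := span (mpolyX _ m); first exact: qhX.
    by exists h; rewrite -hE big_ord0 subr0.
  apply/negP => /(big_rem _) => /(_ _ _ _ xpredT (fun b => `|b|)) sE.
  have : weighted_degree w m <= M.
    by rewrite /M sE (le_trans (ler_norm _)) // lerDl; apply: sumr_ge0.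
  by rewrite leNgt wm.
have := hilbert_complete_intersection w0 e0 (fun i => @qh_mderiv _ _ w f 1 i f_qh) NP dimE.
set ws := [seq w i | i <- _]; set ds := [seq 1 - w i | i <- _] => /bdiff_dual dual.
have ws0 : all (fun e => 0 < e) ws by apply/allP => _ /mapP[i _ ->].
have ds0 : all (fun e => 0 < e) ds by apply/allP => _ /mapP[i _ ->].
have sws : size ws = size ds by rewrite !size_map.
have ss : size s = mu by rewrite size_map size_tuple.
have sumw (F : rat -> rat) : \sum_(e <- ws) F e = \sum_i F (w i).
  by rewrite big_map big_enum.
have sumd (F : rat -> rat) : \sum_(e <- ds) F e = \sum_i F (1 - w i).
  by rewrite big_map big_enum.
have [lo hi] : alpha`_0 - a1 = 0 /\
    alpha`_mu.-1 - a1 = \sum_(e <- ds) e - \sum_(e <- ws) e.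
  apply: (bdiff_dual_extremes ws0 ds0 dual).
  - by apply: map_f; apply: mem_nth; rewrite size_tuple.
  - by apply: map_f; apply: mem_nth; rewrite size_tuple prednK.
  - move=> _ /mapP[a /(nthP 0)[i ia <-] ->].
    rewrite size_tuple in ia.
    rewrite !lerB // (sorted_leq_nth le_trans le_refl) ?inE ?size_tuple ?prednK //.
    by rewrite -ltnS prednK.
have := bdiff_dual_variance sws ws0 dual.
rewrite ss big_map big_tuple !(sumw, sumd) => var.
have mu_neq0 : mu%:R != 0 :> rat by rewrite pnatr_eq0 -lt0n.
have sum0 : \sum_(i < n.+1) 1 = n%:R + 1 :> rat by rewrite sumr_const card_ord -natr1.
have sum1 : \sum_i (1 - w i) = n%:R + 1 - \sum_i w i.
  by rewrite sumrB sum0.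
have sum2 : \sum_i (1 - w i) ^+ 2 = n%:R + 1 - 2 * \sum_i w i + \sum_i w i ^+ 2.
  rewrite -sum0 mulr_sumr -sumrB -big_split /=.
  by apply: eq_bigr => i _; ring.
rewrite (_ : alpha`_mu.-1 - alpha`_0 = n%:R + 1 - 2 * \sum_i w i); last first.
  by move: lo hi; rewrite sumw sumd sum1; lra.
apply: (mulfI mu_neq0); rewrite mulVKf // mulrA.
move: var; rewrite sum1 sum2.
(* By (1 - w)^2 - w^2 = 1 - 2w, the factor in the second moment is also the width of the
   spectrum. *)
rewrite (_ : n%:R + 1 - _ + _ - _ = n%:R + 1 - 2 * \sum_i w i); last by ring.
(* The centres agree: [a1] plus half of [n + 1 - 2 * \sum_i w i] is [(n - 1) / 2]. *)
move=> <-; apply: eq_bigr => i _; rewrite (tnth_nth 0) /a1; congr (_ ^+ 2).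
by field.
Qed.
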